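(* Let $m$ be a positive integer and let $\psi$ be an even primitive Dirichlet character of modulus $m$. Then \begin{align*} L(1,\psi) &=\frac{2\tau(\psi)}{\pi i m^2}\sum_{d\mid m}\frac{d^2}{\varphi(d)} \sum_{\substack{\chi\in\hat{U}_d\\ \chi \text{ odd}}} \mathcal{B}_{-1}(\chi\overline{\psi})\,\tau(\overline{\chi})\,L(2,\chi)\\ &\quad+\frac{\tau(\psi)}{\pi^2 m^2}\sum_{d\mid m}\frac{d^3}{\varphi(d)} \sum_{\substack{\chi\in\hat{U}_d\\ \chi \text{ even}}} \mathcal{B}_{-2}(\chi\overline{\psi})\,\tau(\overline{\chi})\,L(3,\chi) -\frac{m\,\tau(\psi)}{\pi^2}\,\mathcal{B}_{-2}(\overline{\psi})\,\zeta(3)\\ &\quad-\frac{m\,\tau(\psi)}{2\pi^2}\sum_{n=1}^\infty \frac{1}{\binom{2n}{n}n^3}\sum_{0<a<m/2}\frac{\overline{\psi}(a)}{a^2} \left(2\sin\frac{\pi a}{m}\right)^{2n}. \end{align*}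
   Context: For a positive integer $d$, $\hat{U}_d$ denotes the group of Dirichlet characters of modulus $d$ (not necessarily primitive); $\chi$ is called even if $\chi(-1)=1$ and odd if $\chi(-1)=-1$. For $\chi\in\hat U_d$, $L(s,\chi)=\sum_{n\ge1}\chi(n)n^{-s}$, and the Gauss sum is $\tau(\chi)=\sum_{\nu \bmod d}\chi(\nu)e^{2\pi i\nu/d}$, computed with respect to the modulus $d$ of $\chi$. $\overline{\chi}$ is the complex conjugate (inverse) character. $\varphi$ is Euler's totient function and $\zeta$ the Riemann zeta function. For a Dirichlet character $\chi$ of modulus $m$ and an integer $j$, $\mathcal{B}_j(\chi):=\sum_{0<a<m/2}a^j\chi(a)$. For $d\mid m$ and $\chi\in\hat U_d$, the product $\chi\overline{\psi}$ is regarded as a character of modulus $m$, so $\mathcal{B}_j(\chi\overline\psi)=\sum_{0<a<m/2}a^j\chi(a)\overline\psi(a)$.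
   Formalization: The formal theorem assumes m > 1: for m = 1 the only character is trivial and L(1,ψ) is the divergent harmonic series, so the formula has no meaning there. *)

(* Defs.v *)
From HB Require Import structures.
From mathcomp Require Import all_boot all_order all_algebra.
From mathcomp Require Import complex.
From mathcomp Require Import all_classical all_reals all_analysis.
Import Order.TTheory GRing.Theory Num.Theory ComplexField.
Import numFieldTopology.Exports numFieldNormedType.Exports.

Set Implicit Arguments.
Unset Strict Implicit.
Unset Printing Implicit Defensive.

Local Open Scope ring_scope.
Local Open Scope complex_scope.

Definition Cplx (R : realType) : numClosedFieldType := R[i].

Section Dirichlet.
Variable R : realType.
Local Notation C := (Cplx R).

Definition is_dirichlet_char (d : nat) (chi : int -> C) : Prop :=
  [/\ chi 1 = 1,
      (forall a b : int, chi (a * b) = chi a * chi b),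
      (forall a : int, chi (a + d%:Z) = chi a) &
      (forall a : int, chi a != 0 <-> coprimez a d%:Z)].

Definition dchars (d : nat) : set (int -> C) :=
  [set chi | is_dirichlet_char d chi].

Definition even_char (chi : int -> C) : Prop := chi (-1) = 1.
Definition odd_char (chi : int -> C) : Prop := chi (-1) = -1.

Definition induced_by (m d : nat) (psi : int -> C) : Prop :=
  exists chi, is_dirichlet_char d chi /\
    forall a : int, coprimez a m%:Z -> psi a = chi a.

Definition primitive_char (m : nat) (psi : int -> C) : Prop :=
  is_dirichlet_char m psi /\
  forall d : nat, (d %| m)%N -> (d < m)%N -> ~ induced_by m d psi.

Definition conj_char (chi : int -> C) : int -> C := fun a => (chi a)^*.

Definition expi (x : R) : C := (cos x) +i* (sin x).

Definition gauss_sum (d : nat) (chi : int -> C) : C :=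
  \sum_(0 <= nu < d) chi nu%:Z * expi (2 * pi * nu%:R / d%:R).

Definition Lser (s : nat) (chi : int -> C) : C :=
  limn (fun N : nat => \sum_(1 <= n < N) chi n%:Z / (n%:R ^+ s)).

Definition zeta (s : nat) : R :=
  limn (fun N : nat => \sum_(1 <= n < N) (1 / (n%:R ^+ s) : R)).

Definition calB (m : nat) (j : int) (chi : int -> C) : C :=
  \sum_(1 <= a < m | (2 * a < m)%N) (a%:R : C) ^ j * chi a%:Z.

End Dirichlet.

(* Main.v *)
Require Import Defs.
From HB Require Import structures.
From mathcomp Require Import all_boot all_order all_algebra.
From mathcomp Require Import complex ring lra zify.
From mathcomp Require Import cyclic separable cyclotomic.
From mathcomp Require Import all_classical all_reals all_analysis.
Import Order.TTheory GRing.Theory Num.Theory ComplexField.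
Import numFieldTopology.Exports numFieldNormedType.Exports.

(** By Gauss inversion, [L(1, psi)] is a combination of the values at
    [x = pi a / m], [0 < a < m / 2], of [C1 = sum cos(2 n x) / n].  Put
    [S2 = sum sin(2 n x) / n ^ 2] and [C3 = sum cos(2 n x) / n ^ 3].  The key identity is
      [sum (2 sin x) ^ (2 n) / (binom(2 n, n) n ^ 3)
         = - 4 x ^ 2 C1 + 4 x S2 + 2 C3 - 2 zeta(3)]    for [0 < x < pi / 2].
    It needs no termwise differentiation of infinite series: the derivatives of the
    partial sums of both sides telescope, to [4 x ^ 2 cot x] up to a geometrically small
    error on the left, and up to the oscillating term [4 x ^ 2 cos((2 M + 1) x) / sin x]
    on the right, which one explicit integration by parts makes [O(1 / M)].
    Finally [S2] and [C3] are expanded in the values [L(2, chi)] and [L(3, chi)] by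
    grouping the [n] with [gcd(n, m) = m / d] and expanding [e(a k / d)] in the characters
    of modulus [d].  Orthogonality requires enough characters; they are obtained by
    diagonalizing simultaneously the dilations [f |-> f(b .)] on functions on [Z / d]. *)

Set Implicit Arguments.
Unset Strict Implicit.
Unset Printing Implicit Defensive.
Local Open Scope ring_scope.
Local Open Scope classical_set_scope.
Local Notation Re := complex.Re.
Local Notation Im := complex.Im.

(** Every infinite sum of the statement is a [limn], which carries information only once convergence
    is known, and [sum cos(2 n x) / n] converges only conditionally. The key identity is therefore
    an estimate between finite sums with two independent cutoffs, [M] on the trigonometric side and
    [N] on the binomial side. Freezing one and sending the other to infinity gives convergence of
    both, so that of [L(1, psi)] is a consequence. The right side originates in the integral of
    [4 t ^ 2 cot t] from 0 to [x]. The binomial series with [n ^ 2] for [n ^ 3] is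
    [2 arcsin(sin x) ^ 2 = 2 x ^ 2], and [2 cot x] times it is the derivative of the cubic one;
    inserting the formal expansion [cot t = 2 sum sin(2 n t)] and integrating by parts gives [C1],
    [S2], [C3] and [zeta(3)]. The pole of the cotangent at 0 is absorbed by [t ^ 2], and [a < m / 2]
    keeps [sin x < 1]. The modulus 1 is excluded, since there [L(1, psi)] is the harmonic series. *)

Lemma central_binS n : (n.+1 * 'C(n.+1.*2, n.+1) = 2 * n.*2.+1 * 'C(n.*2, n))%N.
Proof.
have e1 : ('C(n.*2.+1, n.+1) = 'C(n.*2.+1, n))%N.
  by rewrite -(@bin_sub n.*2.+1 n); [congr 'C(_, _); lia | lia].
have e2 := mul_bin_diag n.*2.+2 n; have e3 := mul_bin_diag n.*2.+1 n.
rewrite /= in e2 e3; rewrite doubleS -e2 -e1 -mulnA e3; lia.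
Qed.

Lemma central_bin_gt0 n : (0 < 'C(n.*2, n))%N.
Proof. by rewrite bin_gt0; lia. Qed.

(** Hence [(2 sin x)^(2 N) / binom(2 N, N)] is at most [(2 N + 1) (sin x)^(2 N)], the source of the
    decay of [arc_rem]. *)
Lemma central_bin_ge n : (4 ^ n <= n.*2.+1 * 'C(n.*2, n))%N.
Proof.
elim: n => // n IH; have := central_binS n; rewrite expnS; nia.
Qed.

(** * Derivatives of real functions *)

Section RealDerive.
Variable R : realType.
Implicit Types (f g : R -> R) (x a b c : R).

Lemma derD f g x a b : is_derive x 1 f a -> is_derive x 1 g b ->
  is_derive x 1 (fun t => f t + g t) (a + b).
Proof. by move=> hf hg; apply: is_deriveD. Qed.

Lemma derB f g x a b : is_derive x 1 f a -> is_derive x 1 g b ->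
  is_derive x 1 (fun t => f t - g t) (a - b).
Proof. by move=> hf hg; apply: is_deriveB. Qed.

Lemma derM f g x a b : is_derive x 1 f a -> is_derive x 1 g b ->
  is_derive x 1 (fun t => f t * g t) (a * g x + f x * b).
Proof.
move=> hf hg; have := is_deriveM hf hg.
by move/is_derive_eq; apply; rewrite /GRing.scale /= addrC mulrC [f x * _]mulrC [b * _]mulrC mulrC.
Qed.

Lemma derMc f x a c : is_derive x 1 f a -> is_derive x 1 (fun t => f t * c) (a * c).
Proof.
move=> hf; have h := derM hf (is_derive_cst c x 1).
by apply: (is_derive_eq h); rewrite mulr0 addr0.
Qed.

Lemma dercM f x a c : is_derive x 1 f a -> is_derive x 1 (fun t => c * f t) (c * a).
Proof.
move=> hf; have h := derM (is_derive_cst c x 1) hf.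
by apply: (is_derive_eq h); rewrite mul0r add0r.
Qed.

Lemma derX f x a n : is_derive x 1 f a ->
  is_derive x 1 (fun t => f t ^+ n) (n%:R * f x ^+ n.-1 * a).
Proof.
move=> hf; have := is_deriveX n hf; rewrite /GRing.scale /=.
suff -> : (f ^+ n : R -> R) = (fun t => f t ^+ n) by [].
by apply/funext => t; elim: n => // n IH; rewrite !exprS -IH.
Qed.

Lemma der_sum (F : nat -> R -> R) (dF : nat -> R) x m n :
  (forall i, is_derive x 1 (F i) (dF i)) ->
  is_derive x 1 (fun t => \sum_(m <= i < n) F i t) (\sum_(m <= i < n) dF i).
Proof.
move=> h; case: (leqP m n) => mn; last first.
  rewrite big_geq ?(ltnW mn) //; under eq_fun do rewrite big_geq ?(ltnW mn) //.
  exact: is_derive_cst.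
rewrite -(subnKC mn); elim: (n - m)%N => [|k IH].
  rewrite addn0 big_geq //; under eq_fun do rewrite big_geq //.
  exact: is_derive_cst.
rewrite addnS big_nat_recr ?leq_addr //=.
under eq_fun do rewrite big_nat_recr ?leq_addr //=.
exact: derD.
Qed.

Lemma der_id x : is_derive x 1 (fun t : R => t) 1.
Proof. exact: is_derive_id. Qed.

Lemma der_comp f g x a b : is_derive x 1 g b -> is_derive (g x) 1 f a ->
  is_derive x 1 (fun t => f (g t)) (a * b).
Proof. by move=> hg hf; exact: (is_derive1_comp hf hg). Qed.

Lemma der_continuous f x a : is_derive x 1 f a -> {for x, continuous f}.
Proof. by case=> h _; apply/differentiable_continuous/derivable1_diffP. Qed.

(** The mean value theorem for [g - f] stands in for integration: the remainder bounds below come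
    from comparing derivatives. *)
Lemma der_le (f g df dg : R -> R) b : 0 <= b ->
  (forall x, is_derive x 1 f (df x)) -> (forall x, is_derive x 1 g (dg x)) ->
  (forall x, 0 < x < b -> df x <= dg x) -> f 0 = 0 -> g 0 = 0 -> f b <= g b.
Proof.
move=> b0 hf hg le f0 g0.
move: b0; rewrite le_eqVlt => /orP[/eqP <-|b0]; first by rewrite f0 g0.
have hd x : is_derive x 1 (fun t => g t - f t) (dg x - df x) by apply: derB.
have hc : {within `[0, b], continuous (fun t => g t - f t)}.
  by apply: continuous_subspaceT => x; exact: (der_continuous (hd x)).
have [c cb] := MVT b0 (fun x _ => hd x) hc; rewrite in_itv /= in cb.
by rewrite f0 g0 !subr0 => e; rewrite -subr_ge0 e mulr_ge0 ?subr_ge0 ?le ?(ltW b0).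
Qed.

End RealDerive.

(** * Partial sums of the central binomial series and of the trigonometric series *)

Section ArcsinSeries.
Variable R : realType.
Implicit Types (x t : R) (n N M : nat).

Definition cbin n : R := ('C(n.*2, n))%:R.

Lemma cbin_gt0 n : 0 < cbin n.
Proof. by rewrite ltr0n central_bin_gt0. Qed.

Lemma cbinS n : n.+1%:R * cbin n.+1 = 2 * n.*2.+1%:R * cbin n.
Proof. by rewrite /cbin -!natrM central_binS. Qed.

(** [arc_sum 2] truncates [2 arcsin(sin x)^2], which is [2 x^2] on [[0, pi / 2]]; [arc_sum 3]
    truncates the series of the theorem. *)
Definition arc_sum k N x : R :=
  \sum_(1 <= n < N) (2 * sin x) ^+ n.*2 / (cbin n * n%:R ^+ k).

(** Half the derivative of [arc_sum 2], a truncation of [2 x] for [0 <= x < pi / 2]. *)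
Definition arc_odd N x : R :=
  cos x * \sum_(1 <= n < N) 2 * (2 * sin x) ^+ n.*2.-1 / (cbin n * n%:R).

(** The exact defect from 2 of the derivative of [arc_odd]; being increasing on [[0, pi / 2]], it
    also controls the later truncation errors. *)
Definition arc_rem N x : R := 2 * (2 * sin x) ^+ N.*2 / cbin N.

Lemma der_2sin x : is_derive x 1 (fun t => 2 * sin t) (2 * cos x).
Proof. exact: (dercM 2 (is_derive_sin x)). Qed.

(* Telescoping, by [n binom(2n, n) = 2 (2n - 1) binom(2n - 2, n - 1)]. *)
Lemma der_arc_odd N x : is_derive x 1 (arc_odd N.+1) (2 - arc_rem N x).
Proof.
elim: N => [|N IH].
  rewrite /arc_odd; under eq_fun do rewrite big_geq // mulr0.
  by apply: (is_derive_eq (is_derive_cst _ _ _)); rewrite /arc_rem /cbin bin0 expr0 mulr1 divr1 subrr.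
have -> : arc_odd N.+2 = fun t => arc_odd N.+1 t +
    cos t * (2 * sin t) ^+ N.*2.+1 * (2 / (cbin N.+1 * N.+1%:R)).
  by apply/funext => t; rewrite /arc_odd big_nat_recr //= mulrDr; congr (_ + _); ring.
have h := derD IH (derMc (2 / (cbin N.+1 * N.+1%:R))
   (derM (is_derive_cos x) (derX N.*2.+1 (der_2sin x)))).
apply: (is_derive_eq h).
rewrite /arc_rem doubleS /= !exprS.
set S := (2 * sin x) ^+ _.
have c2 : cos x * cos x = 1 - sin x * sin x by rewrite -!expr2 cos2sin2.
have hb := cbinS N.
have p0 := cbin_gt0 N; have p1 := cbin_gt0 N.+1.
have hN : (N.+1%:R : R) != 0 by rewrite pnatr_eq0.
have e1 : (cbin N.+1 : R) = 2 * N.*2.+1%:R * cbin N / N.+1%:R.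
  by rewrite -hb mulrAC mulfV ?mul1r.
have e2 : (N.*2.+1%:R : R) = 2 * N%:R + 1 by rewrite -muln2 -natr1 natrM; ring.
have e3 : (N.+1%:R : R) = N%:R + 1 by rewrite -natr1.
have hN2 : (N.*2.+1%:R : R) != 0 by rewrite pnatr_eq0.
have -> : cos x * (N.*2.+1%:R * S * (2 * cos x)) = (cos x * cos x) * 2 * N.*2.+1%:R * S by ring.
rewrite c2 e1; rewrite e2 in hN2 *; rewrite e3 in hN *.
by field; rewrite hN hN2 (gt_eqF p0).
Qed.

Lemma der_arc_sum2 N x : is_derive x 1 (arc_sum 2 N) (2 * arc_odd N x).
Proof.
have h i : is_derive x 1 (fun t => (2 * sin t) ^+ i.*2 / (cbin i * i%:R ^+ 2))
   ((i.*2%:R * (2 * sin x) ^+ i.*2.-1 * (2 * cos x)) / (cbin i * i%:R ^+ 2)).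
  exact: (derMc _ (derX _ (der_2sin x))).
apply: (is_derive_eq (der_sum 1 N h)).
rewrite /arc_odd mulrA mulr_sumr [LHS]big_nat [RHS]big_nat; apply: eq_bigr => i /andP[i1 _].
have i0 : (i%:R : R) != 0 by rewrite pnatr_eq0 -lt0n.
have := cbin_gt0 i; rewrite -muln2 natrM => p.
by field; rewrite i0 gt_eqF.
Qed.

Lemma der_arc_sum3 N x : is_derive x 1 (arc_sum 3 N) (2 * (cos x / sin x) * arc_sum 2 N x).
Proof.
have h i : is_derive x 1 (fun t => (2 * sin t) ^+ i.*2 / (cbin i * i%:R ^+ 3))
   ((i.*2%:R * (2 * sin x) ^+ i.*2.-1 * (2 * cos x)) / (cbin i * i%:R ^+ 3)).
  exact: (derMc _ (derX _ (der_2sin x))).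
apply: (is_derive_eq (der_sum 1 N h)).
rewrite /arc_sum mulr_sumr [LHS]big_nat [RHS]big_nat; apply: eq_bigr => i /andP[i1 _].
have i0 : (i%:R : R) != 0 by rewrite pnatr_eq0 -lt0n.
have := cbin_gt0 i; rewrite -muln2 natrM => p.
case: i i1 i0 p => // i _ i0 p.
rewrite muln2 doubleS /= [in RHS]exprS.
(* At a zero of the sine, [cos x / sin x] is 0 by convention and the left side vanishes because its
   exponent is positive. The formula thus covers [x = 0], an end of the interval used later. *)
have [s0|s0] := eqVneq (sin x) 0; last by rewrite -natr1 addrC in i0; field; rewrite s0 i0 (gt_eqF p).
by rewrite s0 !mulr0 exprS !mul0r !mulr0 ?mul0r.
Qed.

Lemma arc_sum_at0 k N : arc_sum k N 0 = 0.
Proof.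
by rewrite /arc_sum big_nat big1 // => -[|i] // _; rewrite sin0 mulr0 doubleS exprS !mul0r.
Qed.

Lemma arc_odd_at0 N : arc_odd N 0 = 0.
Proof.
rewrite /arc_odd big_nat big1 ?mulr0 // => -[|i] // _.
by rewrite sin0 mulr0 doubleS exprS !(mul0r, mulr0).
Qed.

Lemma sin_ge0_half x : 0 <= x <= pi / 2 -> 0 <= sin x.
Proof. by move=> /andP[h1 h2]; apply: sin_ge0_pi; have := pi_ge0 R; lra. Qed.

Lemma arc_rem_le N x t : 0 <= t <= x -> x <= pi / 2 -> 0 <= arc_rem N t <= arc_rem N x.
Proof.
move=> /andP[t0 tx] xp.
have s0 : 0 <= sin t by apply: sin_ge0_half; lra.
have s1 : sin t <= sin x.
  by have := pi_gt0 R => p0; rewrite leNgt ltr_sin -?leNgt ?in_itv //=; lra.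
have := cbin_gt0 N => p.
rewrite /arc_rem; apply/andP; split.
  by apply: divr_ge0 (ltW p); apply/mulr_ge0/exprn_ge0/mulr_ge0.
rewrite ler_pM2r ?invr_gt0 // ler_pM2l //.
by apply: lerXn2r; rewrite ?nnegrE; lra.
Qed.

(** The middle term has derivative [arc_rem N t], which lies between 0 and [arc_rem N x] for
    [t <= x]; comparing from 0 gives both bounds. One more such step gives [arc_sum2_bounds]. *)
Lemma arc_odd_bounds N x : 0 <= x <= pi / 2 ->
  0 <= 2 * x - arc_odd N.+1 x <= arc_rem N x * x.
Proof.
move=> /andP[x0 xp].
have d0 t : is_derive t 1 (fun t => 2 * t - arc_odd N.+1 t) (2 * 1 - (2 - arc_rem N t)).
  exact: (derB (dercM 2 (der_id t)) (der_arc_odd N t)).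
apply/andP; split.
  apply: (@der_le _ (fun=> 0) _ (fun=> 0) _ x x0 _ d0) => //.
  - by move=> t /andP[t0 tx]; have := @arc_rem_le N x t; lra.
  - by rewrite arc_odd_at0; lra.
apply: (@der_le _ _ (fun t => arc_rem N x * t) _ (fun=> arc_rem N x * 1) x x0 d0
  (fun t => dercM _ (der_id t))).
- by move=> t /andP[t0 tx]; have := @arc_rem_le N x t; lra.
- by rewrite arc_odd_at0; lra.
- by rewrite mulr0.
Qed.

Lemma arc_sum2_bounds N x : 0 <= x <= pi / 2 ->
  0 <= 2 * x ^+ 2 - arc_sum 2 N.+1 x <= arc_rem N x * x ^+ 2.
Proof.
move=> /andP[x0 xp].
have hX (t : R) := derX 2 (der_id t).
have d0 t : is_derive t 1 (fun t => 2 * t ^+ 2 - arc_sum 2 N.+1 t)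
   (2 * (2%:R * t ^+ 1 * 1) - 2 * arc_odd N.+1 t).
  exact: (derB (dercM 2 (hX t)) (der_arc_sum2 N.+1 t)).
apply/andP; split.
  apply: (@der_le _ (fun=> 0) _ (fun=> 0) _ x x0 _ d0) => //.
  - by move=> t /andP[t0 tx]; have := @arc_odd_bounds N t; rewrite expr1; lra.
  - by rewrite arc_sum_at0 expr0n /=; lra.
apply: (@der_le _ _ (fun t => arc_rem N x * t ^+ 2) _ (fun t => arc_rem N x * (2%:R * t ^+ 1 * 1)) x x0 d0
  (fun t => dercM _ (hX t))).
- move=> t /andP[t0 tx]; have h1 := @arc_odd_bounds N t; have h2 := @arc_rem_le N x t.
  have h3 : arc_rem N t * t <= arc_rem N x * t by rewrite ler_pM2r //; lra.
  by rewrite expr1; lra.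
- by rewrite arc_sum_at0 expr0n /=; lra.
- by rewrite expr0n mulr0.
Qed.

(** This is [x cot x <= 1], which compensates the pole of the cotangent at 0. *)
Lemma sin_ge_xcos x : 0 <= x <= pi / 2 -> x * cos x <= sin x.
Proof.
move=> /andP[x0 xp].
apply: (@der_le _ (fun t => t * cos t) sin (fun t => 1 * cos t + t * (- sin t)) cos x x0
  (fun t => derM (der_id t) (is_derive_cos t)) (@is_derive_sin R)).
- move=> t /andP[t0 tx].
  have : 0 <= t * sin t by apply/mulr_ge0/sin_ge0_half; lra.
  lra.
- by rewrite mul0r.
- by rewrite sin0.
Qed.

(** * Trigonometric sums and the oscillating term *)

Definition cos_sum k M x : R := \sum_(1 <= n < M) cos (n.*2%:R * x) / n%:R ^+ k.
Definition sin_sum k M x : R := \sum_(1 <= n < M) sin (n.*2%:R * x) / n%:R ^+ k.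
(* The combination whose derivative loses all cosine sums, see [der_clausen]. *)
Definition clausen M x : R :=
  - 4 * x ^+ 2 * cos_sum 1 M x + 4 * x * sin_sum 2 M x
  + 2 * cos_sum 3 M x - 2 * cos_sum 3 M 0.

Lemma der_cosM c x : is_derive x 1 (fun t => cos (c * t)) (- sin (c * x) * c).
Proof.
have h := dercM c (der_id x); rewrite mulr1 in h.
exact: (der_comp h (is_derive_cos (c * x))).
Qed.

Lemma der_sinM c x : is_derive x 1 (fun t => sin (c * t)) (cos (c * x) * c).
Proof.
have h := dercM c (der_id x); rewrite mulr1 in h.
exact: (der_comp h (is_derive_sin (c * x))).
Qed.

Lemma der_cos_sum k M x : is_derive x 1 (cos_sum k.+1 M) (- 2 * sin_sum k M x).
Proof.
have h i : is_derive x 1 (fun t => cos (i.*2%:R * t) / i%:R ^+ k.+1)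
   ((- sin (i.*2%:R * x) * i.*2%:R) / i%:R ^+ k.+1).
  exact: (derMc _ (der_cosM _ _)).
apply: (is_derive_eq (der_sum 1 M h)).
rewrite /sin_sum mulr_sumr [LHS]big_nat [RHS]big_nat; apply: eq_bigr => i /andP[i1 _].
have i0 : (i%:R : R) != 0 by rewrite pnatr_eq0 -lt0n.
by rewrite -muln2 natrM exprS; field; rewrite i0 expf_neq0.
Qed.

Lemma der_sin_sum k M x : is_derive x 1 (sin_sum k.+1 M) (2 * cos_sum k M x).
Proof.
have h i : is_derive x 1 (fun t => sin (i.*2%:R * t) / i%:R ^+ k.+1)
   ((cos (i.*2%:R * x) * i.*2%:R) / i%:R ^+ k.+1).
  exact: (derMc _ (der_sinM _ _)).
apply: (is_derive_eq (der_sum 1 M h)).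
rewrite /cos_sum mulr_sumr [LHS]big_nat [RHS]big_nat; apply: eq_bigr => i /andP[i1 _].
have i0 : (i%:R : R) != 0 by rewrite pnatr_eq0 -lt0n.
by rewrite -muln2 natrM exprS; field; rewrite i0 expf_neq0.
Qed.

(** [2 sin x sin(2 n x) = cos((2 n - 1) x) - cos((2 n + 1) x)] telescopes. The sum ends at [n = M],
    whence the frequency [2 M + 1]. *)
Lemma sin_sum0 M x :
  2 * sin x * sin_sum 0 M.+1 x = cos x - cos (M.*2.+1%:R * x).
Proof.
elim: M => [|M IH]; first by rewrite /sin_sum big_geq // mulr0 mul1r subrr.
rewrite /sin_sum big_nat_recr //= mulrDr IH expr0 divr1.
have -> : (M.*2.+1%:R : R) * x = M.+1.*2%:R * x - x by rewrite doubleS -!natr1; ring.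
have -> : (M.+1.*2.+1%:R : R) * x = M.+1.*2%:R * x + x by rewrite doubleS -!natr1; ring.
by rewrite cosB cosD; ring.
Qed.

(** With [C1], [S2], [S0] for the truncated sums, the product rule gives [- 8 x C1 + 8 x^2 S0 + 4 S2
    + 8 x C1 - 4 S2]: the coefficients of [clausen] are those that make everything but [8 x^2 S0]
    cancel. *)
Lemma der_clausen M x : is_derive x 1 (clausen M) (8 * x ^+ 2 * sin_sum 0 M x).
Proof.
have h1 := derM (dercM (- 4) (derX 2 (der_id x))) (der_cos_sum 0 M x).
have h2 := derM (dercM 4 (der_id x)) (der_sin_sum 1 M x).
have h3 := dercM 2 (der_cos_sum 2 M x).
have h := derB (derD (derD h1 h2) h3) (is_derive_cst (2 * cos_sum 3 M 0) x 1).
by apply: (is_derive_eq h); rewrite /=; ring.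
Qed.

Lemma clausen_at0 M : clausen M 0 = 0.
Proof. by rewrite /clausen expr0n /=; ring. Qed.

(* The boundary term of the integration by parts of [x ^ 2 cos(c x) / sin x]; at [x = 0]
   the convention [0 / 0 = 0] gives the continuous extension. *)
Definition osc c x : R := x ^+ 2 / sin x * (sin (c * x) / c).
(** The first summand, written through the bounded quotient [x / sin x], carries the small factor
    [1 / c]; the second is the oscillating term to be removed. *)
Definition dosc c x : R :=
  (2 * (x / sin x) - (x / sin x) ^+ 2 * cos x) * (sin (c * x) / c) +
  x ^+ 2 / sin x * cos (c * x).

Lemma der_osc c x : c != 0 -> sin x != 0 -> is_derive x 1 (osc c) (dosc c x).
Proof.
move=> c0 s0.
have hV := is_deriveV s0 (is_derive_sin x).
have h := derM (derM (derX 2 (der_id x)) hV) (derMc c^-1 (der_sinM c x)).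
apply: (is_derive_eq h); rewrite /dosc /GRing.scale /=.
by field; rewrite c0 s0.
Qed.

Lemma xdivsin_bound x0 x : 0 < x <= x0 -> x0 < pi / 2 -> 0 <= x / sin x <= (cos x0)^-1.
Proof.
move=> /andP[h0 h1] h2.
have s0 : 0 < sin x by apply: sin_gt0_pihalf; lra.
have c0 : 0 < cos x0 by apply: cos_gt0_pihalf; lra.
apply/andP; split; first by apply: divr_ge0; lra.
rewrite ler_pdivrMr // mulrC ler_pdivlMr //.
apply: le_trans (@sin_ge_xcos x _); last lra.
rewrite ler_pM2l // leNgt ltr_cos -?leNgt ?in_itv //=; lra.
Qed.

Lemma osc_cvg0 c x0 : 0 < x0 < pi / 2 -> osc c x @[x --> 0^'+] --> osc c 0.
Proof.
move=> /andP[h0 h1].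
have c0 : 0 < cos x0 by apply: cos_gt0_pihalf; lra.
rewrite /osc expr0n !mul0r.
apply/cvgr0Pnorm_lt => e e0.
(* The added 1 keeps [B] positive even when [c^-1] is 0. *)
set B := (cos x0)^-1 * (`|c^-1| + 1).
have B0 : 0 < B by rewrite mulr_gt0 ?invr_gt0 // ltr_wpDl.
have eB : 0 < e / B by apply: divr_gt0.
near=> x.
have x_gt0 : 0 < x by near: x; exact: nbhs_right_gt.
have xx0 : x <= x0 by near: x; exact: nbhs_right_le.
have xe : x < e / B by near: x; exact: nbhs_right_lt.
have /andP[q0 q1] : 0 <= x / sin x <= (cos x0)^-1 by apply: xdivsin_bound; rewrite ?x_gt0.
have -> : x ^+ 2 / sin x * (sin (c * x) / c) = x * (x / sin x * (sin (c * x) / c)) by ring.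
rewrite normrM gtr0_norm //; apply: (@le_lt_trans _ _ (x * B)); last by rewrite -ltr_pdivlMr.
rewrite ler_pM2l // /B normrM ger0_norm //; apply: ler_pM => //.
rewrite normrM; apply: (@le_trans _ _ (1 * `|c^-1|)); last by rewrite mul1r lerDl.
by apply: ler_wpM2r => //; exact: sin_max.
Unshelve. all: by end_near.
Qed.

(** The mean value theorem is applied to the difference of the two sides corrected by [4 * osc c].
    The constant [D] depends on [x] only, so [N] and [M] can tend to infinity separately. *)
Lemma clausen_arc_sum x : 0 < x < pi / 2 -> exists D : R, forall N M,
  `|clausen M.+1 x - arc_sum 3 N.+1 x| <= 2 * arc_rem N x * x ^+ 2 + D / M.*2.+1%:R.
Proof.
move=> /andP[x0 xp].
have c0 : 0 < cos x by apply: cos_gt0_pihalf; lra.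
set B := (cos x)^-1.
have B0 : 0 < B by rewrite invr_gt0.
(* The first summand bounds the [1 / c] part of [4 * dosc] times the length [x] of the interval; the
   second bounds the boundary term [4 * osc c x]. *)
exists (4 * (2 * B + B ^+ 2) * x + 4 * (x ^+ 2 / sin x)) => N M.
set c : R := M.*2.+1%:R.
have cp : 0 < c by rewrite ltr0n.
have cn : c != 0 by rewrite gt_eqF.
(* By [sin_sum0], [8 t^2 sin_sum 0] is [4 t^2 cot t - 4 t^2 cos(c t) / sin t]; the derivative of
   [4 * osc] removes the last term. *)
pose H t := clausen M.+1 t - arc_sum 3 N.+1 t + 4 * osc c t.
pose dH t := 8 * t ^+ 2 * sin_sum 0 M.+1 t - 2 * (cos t / sin t) * arc_sum 2 N.+1 t
   + 4 * dosc c t.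
have sp t : 0 < t <= x -> 0 < sin t by move=> ht; apply: sin_gt0_pihalf; lra.
have hd t : 0 < t <= x -> is_derive t 1 H (dH t).
  move=> /sp st; apply: derD (derB (der_clausen _ _) (der_arc_sum3 _ _)) (dercM 4 (der_osc cn _)).
  by rewrite gt_eqF.
have hc : {within `[0, x], continuous H}.
  apply/continuous_within_itvP => //; split.
  - move=> t; rewrite in_itv /= => ht; apply: (der_continuous (hd t _)); lra.
  (* [der_osc] does not apply where the sine vanishes; at 0 the one-sided limit of [osc] is used
     instead. *)
  - apply: cvgD; last by apply: cvgMr; apply: (@osc_cvg0 c x); lra.
    have h0 := der_continuous (derB (der_clausen M.+1 0) (der_arc_sum3 N.+1 0)).
    exact: cvg_at_right_filter h0.
  - apply: cvg_at_left_filter; apply: (der_continuous (hd x _)); lra.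
have hdo t : t \in `]0, x[%R -> is_derive t 1 H (dH t).
  by rewrite in_itv /= => ht; apply: hd; lra.
have [t tx] := MVT x0 hdo hc; rewrite in_itv /= in tx.
have H0 : H 0 = 0 by rewrite /H clausen_at0 arc_sum_at0 /osc expr0n !mul0r; ring.
rewrite H0 !subr0 => Hx.
have st : 0 < sin t by apply: sp; lra.
have ct : 0 < cos t by apply: cos_gt0_pihalf; lra.
(* The two terms [4 t^2 cot t] cancel, leaving the truncation error of [arc_sum 2] and the [1 / c]
   part of [dosc]. *)
have dHE : dH t = 2 * (cos t / sin t) * (2 * t ^+ 2 - arc_sum 2 N.+1 t) +
   4 * ((2 * (t / sin t) - (t / sin t) ^+ 2 * cos t) * (sin (c * t) / c)).
  have h := sin_sum0 M t.
  have -> : dH t = 4 * (t ^+ 2 / sin t) * (2 * sin t * sin_sum 0 M.+1 t)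
     - 2 * (cos t / sin t) * arc_sum 2 N.+1 t + 4 * dosc c t.
    by rewrite /dH; field; rewrite gt_eqF.
  rewrite h /dosc -/c; clearbody c; field.
  by rewrite cn gt_eqF.
have /andP[q0 q1] : 0 <= t / sin t <= B by apply: xdivsin_bound; lra.
have q2 : (t / sin t) * cos t <= 1.
  by rewrite mulrAC ler_pdivrMr // mul1r; apply: sin_ge_xcos; lra.
have e1 : `|2 * (cos t / sin t) * (2 * t ^+ 2 - arc_sum 2 N.+1 t)| <= 2 * arc_rem N x * x.
  have /andP[a0 a1] := @arc_sum2_bounds N t ltac:(lra).
  have /andP[r0 r1] := @arc_rem_le N x t ltac:(lra) ltac:(lra).
  have k0 : 0 <= cos t / sin t by apply: divr_ge0; lra.
  rewrite ger0_norm; last by apply: mulr_ge0 => //; apply: mulr_ge0.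
  apply: (@le_trans _ _ (2 * (cos t / sin t) * (arc_rem N t * t ^+ 2))).
    by apply: ler_wpM2l => //; apply: mulr_ge0.
  have -> : 2 * (cos t / sin t) * (arc_rem N t * t ^+ 2) =
    2 * (arc_rem N t * (t * (t / sin t * cos t))) by ring.
  rewrite -[leRHS]mulrA ler_pM2l //; apply: ler_pM => //.
    by apply: mulr_ge0; [lra|apply: mulr_ge0 => //; lra].
  apply: (@le_trans _ _ (t * 1)); last lra.
  by apply: ler_wpM2l => //; lra.
have e2 : `|(2 * (t / sin t) - (t / sin t) ^+ 2 * cos t) * (sin (c * t) / c)| <= (2 * B + B ^+ 2) / c.
  rewrite [X in `|X|]mulrA normrM [`|c^-1|]gtr0_norm ?invr_gt0 // ler_pM2r ?invr_gt0 //.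
  rewrite normrM -[leRHS]mulr1; apply: ler_pM => //; last exact: sin_max.
  rewrite (le_trans (ler_normB _ _)) // ger0_norm; last by apply: mulr_ge0.
  rewrite normrM ger0_norm ?sqr_ge0 //.
  apply: lerD; first by rewrite ler_pM2l.
  rewrite -[leRHS]mulr1; apply: ler_pM => //; first exact: sqr_ge0.
    by apply: lerXn2r; rewrite ?nnegrE //; lra.
  exact: cos_max.
have e3 : `|osc c x| <= x ^+ 2 / sin x / c.
  have s0 : 0 < sin x by apply: sp; lra.
  rewrite /osc normrM ger0_norm; last by apply: divr_ge0; rewrite ?sqr_ge0 // ltW.
  rewrite ler_wpM2l //; first by apply: divr_ge0; rewrite ?sqr_ge0 // ltW.
  rewrite normrM [`|c^-1|]gtr0_norm ?invr_gt0 // -[leRHS]mul1r ler_pM2r ?invr_gt0 //.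
  exact: sin_max.
have e4 : `|H x| <= (2 * arc_rem N x * x + 4 * ((2 * B + B ^+ 2) / c)) * x.
  rewrite Hx normrM [`|x|]gtr0_norm // ler_pM2r // dHE.
  apply: (le_trans (ler_normD _ _)); apply: lerD => //.
  by rewrite normrM ger0_norm // ler_pM2l.
have -> : clausen M.+1 x - arc_sum 3 N.+1 x = H x - 4 * osc c x by rewrite /H; ring.
apply: (le_trans (ler_normB _ _)).
rewrite [`|4 * _|]normrM [`|4|]ger0_norm //.
have -> : 2 * arc_rem N x * x ^+ 2 + (4 * (2 * B + B ^+ 2) * x + 4 * (x ^+ 2 / sin x)) / c =
  (2 * arc_rem N x * x + 4 * ((2 * B + B ^+ 2) / c)) * x + 4 * (x ^+ 2 / sin x / c).
  by ring.
by apply: lerD => //; rewrite ler_pM2l.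
Qed.
End ArcsinSeries.

(** * Convergence, and passage to the limit in the key identity *)

Section RealLimits.
Variable R : realType.
Implicit Types (x t : R) (n N M : nat) (u v : nat -> R).

Lemma cvg_bounded_dirichlet u k : (1 < k)%N -> (forall n, `|u n| <= 1) ->
  cvgn (fun N => \sum_(1 <= n < N) u n / n%:R ^+ k).
Proof.
move=> k1 hu.
have k0 : (0 < k)%N by apply: ltnW.
(* [series] starts at 0, where the term vanishes because [0 ^+ k] has inverse 0. *)
have sE (v : nat -> R) : (fun N => \sum_(1 <= n < N) v n / n%:R ^+ k) =
    series (fun n => v n / n%:R ^+ k).
  apply/funext => -[|N]; rewrite /series /=; first by rewrite !big_geq.
  by rewrite [RHS]big_ltn // expr0n gtn_eqF // invr0 mulr0 add0r.
rewrite sE; apply: normed_cvg.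
pose w (n : nat) : R := 1 / n%:R ^+ k.
apply: (@series_le_cvg _ _ w) => [n|n|n|].
- exact: normr_ge0.
- by apply: divr_ge0 => //; apply: exprn_ge0.
- rewrite /= normrM normfV normrX normr_nat /w ler_wpM2r // invr_ge0; exact: exprn_ge0.
rewrite -sE; apply: nondecreasing_is_cvgn.
  apply: nondecreasing_series => n _ _; apply: divr_ge0 => //; exact: exprn_ge0.
(* The sum up to [N] is at most [2 - 1 / N], by telescoping [1 / n^2 <= 1 / (n - 1) - 1 / n]. *)
exists 2 => _ [N _ <-].
case: N => [|[|N]]; [by rewrite big_geq | by rewrite big_geq |].
apply: (@le_trans _ _ (2 - N.+1%:R^-1)); last by rewrite lerBlDr lerDl.
elim: N => [|N IH].
  by rewrite big_nat1 !(expr1n, invr1, mulr1n); lra.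
rewrite big_nat_recr //=; apply: (le_trans (lerD IH (lexx _))).
have h : 1 / N.+2%:R ^+ k <= 1 / (N.+1%:R * N.+2%:R) :> R.
  rewrite !mul1r lef_pV2 ?posrE ?exprn_gt0 ?mulr_gt0 ?ltr0n //.
  rewrite -natrM -natrX ler_nat.
  apply: (@leq_trans (N.+2 ^ 2)); last by rewrite leq_exp2l.
  by rewrite expnS expn1; apply: leq_mul.
suff h2 : 1 / (N.+1%:R * N.+2%:R) = N.+1%:R^-1 - N.+2%:R^-1 :> R.
  by rewrite h2 in h; move: h; set a := N.+1%:R^-1; set b := N.+2%:R^-1; lra.
have n1 : (N.+1%:R : R) != 0 by rewrite pnatr_eq0.
have n2 : (N.+2%:R : R) != 0 by rewrite pnatr_eq0.
have -> : 1 / (N.+1%:R * N.+2%:R) = (N.+2%:R - N.+1%:R) / (N.+1%:R * N.+2%:R) :> R.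
  by congr (_ / _); rewrite -[N.+2%:R]natr1; ring.
rewrite mulrBl.
have -> : N.+2%:R / (N.+1%:R * N.+2%:R) = N.+1%:R^-1 :> R.
  by rewrite invfM mulrCA mulfV // mulr1.
have -> : N.+1%:R / (N.+1%:R * N.+2%:R) = N.+2%:R^-1 :> R.
  by rewrite invfM mulrA mulfV // mul1r.
by [].
Qed.

Lemma cvg_arc_rem x : 0 < x < pi / 2 -> arc_rem N x @[N --> \oo] --> (0 : R).
Proof.
move=> hx.
have s0 : 0 < sin x by apply: sin_gt0_pihalf.
have s1 : sin x < 1.
  by rewrite -sin_pihalf; rewrite ltr_sin ?in_itv /=; have := pi_gt0 R; lra.
set y := sin x in s0 s1.
pose d := y^-1 - 1.
have d0 : 0 < d by rewrite subr_gt0 invf_gt1.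
have bern n : 1 + n%:R * d <= y ^- n.
  elim: n => [|n IH]; first by rewrite mul0r addr0 expr0 invr1.
  rewrite exprS invfM; have -> : y^-1 = 1 + d by rewrite /d; ring.
  apply: (le_trans _ (ler_wpM2l _ IH)); last by lra.
  rewrite -natr1.
  have : 0 <= n%:R * d * d by rewrite !mulr_ge0 // ltW.
  lra.
(* Chosen so that [2 N + 1 <= K (1 + N d)]. By the Bernoulli bound, half of the power [y^(2 N)] then
   absorbs the factor [2 N + 1], and [y^N] remains. *)
pose K := 2 / d + 1.
have K0 : 0 < K by rewrite addr_gt0 ?divr_gt0.
have bd N : arc_rem N x <= (2 * K) * y ^+ N.
  have c0 := cbin_gt0 R N.
  rewrite /arc_rem -/y ler_pdivrMr // exprMn.
  have -> : 2 * K * y ^+ N * cbin R N = 2 * (K * (y ^+ N * cbin R N)) by ring.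
  rewrite ler_pM2l //.
  have h4 : (2 ^+ N.*2 : R) <= N.*2.+1%:R * cbin R N.
    rewrite /cbin -natrM -natrX ler_nat -[X in (2 ^ X)%N]mul2n expnM.
    exact: central_bin_ge.
  have hK : N.*2.+1%:R * y ^+ N <= K.
    have yN : 0 < y ^+ N by apply: exprn_gt0.
    rewrite -ler_pdivlMr //; apply: (@le_trans _ _ (K * (1 + N%:R * d))); last first.
      by rewrite ler_pM2l.
    have -> : K * (1 + N%:R * d) = 2 / d + 1 + 2 * N%:R + N%:R * d.
      by rewrite /K; clearbody d; field; rewrite gt_eqF.
    rewrite -natr1 -muln2 natrM.
    have : 0 <= N%:R * d by rewrite mulr_ge0 // ltW.
    have : 0 < 2 / d by rewrite divr_gt0.
    lra.
  apply: (@le_trans _ _ (N.*2.+1%:R * cbin R N * y ^+ N.*2)).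
    by rewrite ler_wpM2r // ltW // exprn_gt0.
  have -> : N.*2.+1%:R * cbin R N * y ^+ N.*2 = (N.*2.+1%:R * y ^+ N) * (y ^+ N * cbin R N).
    by rewrite -addnn exprD; ring.
  by rewrite ler_pM2r // mulr_gt0 // exprn_gt0.
apply: (@squeeze_cvgr _ _ _ _ (fun=> 0) (fun N => (2 * K) * y ^+ N)).
- near=> N; rewrite bd andbT.
  by have := @arc_rem_le R N x x; lra.
- exact: cvg_cst.
- rewrite -[X in _ --> X](mulr0 (2 * K)); apply: cvgMr.
  by apply: cvg_expr; rewrite gtr0_norm.
Unshelve. all: by end_near.
Qed.

(** The estimate serves twice: at a fixed [M] it bounds the increasing sums [arc_sum 3]; after [N]
    has tended to infinity it forces [clausen] to the same limit. In [clausen] only [cos_sum 1] is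
    then unknown, and its coefficient [- 4 x^2] is nonzero. *)
Lemma cvg_cos_sum1 x (S2 C3 Z : R) : 0 < x < pi / 2 ->
  sin_sum 2 M x @[M --> \oo] --> S2 -> cos_sum 3 M x @[M --> \oo] --> C3 ->
  cos_sum 3 M 0 @[M --> \oo] --> Z ->
  exists2 F : R, arc_sum 3 N x @[N --> \oo] --> F &
   cos_sum 1 M x @[M --> \oo] --> (4 * x * S2 + 2 * C3 - 2 * Z - F) / (4 * x ^+ 2).
Proof.
move=> hx hS hC hZ.
have [D hD] := clausen_arc_sum hx.
have hr := cvg_arc_rem hx.
have c1 : cvgn (fun N => arc_sum 3 N x).
  apply: nondecreasing_is_cvgn.
    apply: nondecreasing_series => n _ _; apply: divr_ge0.
      by apply/exprn_ge0/mulr_ge0/sin_ge0_half => //; lra.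
    by apply/mulr_ge0/exprn_ge0 => //; apply/ltW/cbin_gt0.
  have [U hU] : has_ubound (range (fun N => arc_rem N x)).
    exact/bounded_fun_has_ubound/cvg_seq_bounded/cvgP/hr.
  (* The estimate at [M = 0], with [U] bounding [arc_rem]; the 0 in the maximum covers the empty sum
     [N = 0]. *)
  exists (Num.max 0 (clausen 1 x + (2 * U * x ^+ 2 + D / (0%N.*2).+1%:R))) => _ [N _ <-].
  rewrite le_max; case: N => [|N]; first by rewrite /arc_sum big_geq ?lexx.
  apply/orP; right; have := hD N 0%N.
  have h2 : arc_rem N x <= U by apply: hU; exists N.
  have x2 : 0 < x ^+ 2 by rewrite exprn_gt0; lra.
  rewrite ler_norml => /andP[h3 h4].
  have : 2 * arc_rem N x * x ^+ 2 <= 2 * U * x ^+ 2 by rewrite ler_pM2r // ler_pM2l.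
  move: h3; set B := D / _; set A := 2 * arc_rem _ _ * _; set A2 := 2 * U * _; set f := arc_sum _ _ _; set c := clausen _ _; lra.
exists (limn (fun N => arc_sum 3 N x)) => //.
set F := limn _.
have hb M : `|clausen M.+1 x - F| <= D / M.*2.+1%:R.
  have l1 : `|clausen M.+1 x - arc_sum 3 N.+1 x| @[N --> \oo] --> `|clausen M.+1 x - F|.
    apply: cvg_norm; apply: cvgB; first exact: cvg_cst.
    by have := c1; rewrite -(cvg_shiftS (fun N => arc_sum 3 N x)).
  have l2 : 2 * arc_rem N x * x ^+ 2 + D / M.*2.+1%:R @[N --> \oo] --> D / M.*2.+1%:R.
    rewrite -[X in _ --> X]add0r; apply: cvgD; last exact: cvg_cst.
    rewrite -(mul0r (x ^+ 2)); apply: cvgMl.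
    by rewrite -(mulr0 2); apply: cvgMr.
  by apply: (ler_cvg_to l1 l2); near=> N; exact: hD.
have hcl : clausen M x @[M --> \oo] --> F.
  rewrite -(cvg_shiftS (fun M => clausen M x)) /=.
  apply/subr_cvg0; apply/cvgr0Pnorm_le => e e0.
  have hh : D * harmonic M @[M --> \oo] --> (0 : R).
    by rewrite -(mulr0 D); apply: cvgMr; exact: cvg_harmonic.
  move/cvgr0Pnorm_le: hh => /(_ e e0) hh.
  near=> M; apply: (le_trans (hb M)).
  have h1 : `|D * harmonic M| <= e by near: M.
  apply: le_trans h1; apply: (le_trans (ler_norm _)).
  rewrite !normrM ler_wpM2l // /harmonic /= !normfV !ger0_norm ?ler0n //.
  by rewrite lef_pV2 ?posrE ?ltr0n // ler_nat; lia.
have x0 : 0 < x by lra.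
have E : (fun M => cos_sum 1 M x) =1 fun M =>
  (4 * x * sin_sum 2 M x + 2 * cos_sum 3 M x - 2 * cos_sum 3 M 0 - clausen M x) / (4 * x ^+ 2).
  by move=> k; rewrite /clausen; field; rewrite gt_eqF.
rewrite (eq_cvg _ _ E).
apply: cvgMl; apply: cvgB hcl; apply: cvgB; last by apply: cvgMr.
by apply: cvgD; apply: cvgMr.
Unshelve. all: by end_near.
Qed.
End RealLimits.

(** * Dirichlet characters *)

Section Separation.
Variables (C : numClosedFieldType) (n : nat).
Local Notation d := n.+1.

(* Acts on row vectors, seen as functions on [Z / d], by [f |-> f(b .)]. *)
Definition dil_mx (b : nat) : 'M[C]_d :=
  \matrix_(j, i) (j == inZp (b * i))%:R.

Lemma mul_dil_mx (f : 'rV[C]_d) b i : (f *m dil_mx b) 0 i = f 0 (inZp (b * i)).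
Proof.
rewrite mxE (bigD1 (inZp (b * i))) //= mxE eqxx mulr1 big1 ?addr0 // => j ji.
by rewrite mxE (negbTE ji) mulr0.
Qed.

Lemma inZp_mul_mod b k : (inZp (b * (k %% d)) : 'I_d) = inZp (b * k).
Proof. by apply: val_inj; rewrite /= modnMmr. Qed.

Lemma dil_mxM b c : dil_mx b *m dil_mx c = dil_mx (b * c).
Proof.
apply/row_matrixP => l; rewrite row_mul; apply/rowP => i.
rewrite mul_dil_mx !mxE.
by congr (_ == _)%:R; rewrite /= inZp_mul_mod mulnA.
Qed.

Lemma dil_mx_mod b c : (b = c %[mod d])%N -> dil_mx b = dil_mx c.
Proof.
move=> bc; apply/matrixP => j i; rewrite !mxE; congr (_ == _)%:R.
by apply: val_inj; rewrite /= -modnMml bc modnMml.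
Qed.

Lemma dil_mx1 : dil_mx 1 = 1.
Proof.
apply/matrixP => j i; rewrite !mxE mul1n; congr (nat_of_bool _)%:R.
by congr (_ == _); apply: val_inj; rewrite /= modn_small.
Qed.

(** By Euler's theorem the power [totient d] is the identity, and [X^k - 1] is separable in
    characteristic 0. *)
Lemma dil_mx_diag b : coprime b d -> diagonalizable (dil_mx b).
Proof.
move=> bd; apply/diagonalizableP.
set k := totient d.
have k0 : (0 < k)%N by rewrite totient_gt0.
have kC : (k%:R : C) != 0 by rewrite pnatr_eq0 -lt0n.
have [r hr] := closed_field_poly_normal ('X^k - 1 : {poly C}).
rewrite lead_coefXnsubC // scale1r in hr.
exists r.
  by rewrite -separable_prod_XsubC -hr; exact: separable_Xn_sub_1.
rewrite -hr; apply: mxminpoly_min.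
rewrite rmorphB rmorphXn /= horner_mx_X rmorph1.
have pw j : dil_mx b ^+ j = dil_mx (b ^ j).
  by elim: j => [|j IH]; rewrite ?expr0 ?dil_mx1 // exprS IH expnS -dil_mxM.
rewrite pw (dil_mx_mod (Euler_exp_totient bd)) dil_mx1.
exact: subrr.
Qed.

(** The rows of [P] form a common eigenbasis. If every row nonzero at 1 had eigenvalue 1 at [a],
    then all rows, hence all functions, would agree at [a] and 1, against the delta function at
    1. *)
Lemma separating_function (a : nat) : coprime a d -> (a != 1 %[mod d])%N ->
  exists (p : 'rV[C]_d) (l : nat -> C), [/\ p 0 (inZp 1) != 0, l a != 1 &
    forall b k, coprime b d -> p 0 (inZp (b * k)) = l b * p 0 (inZp k)].
Proof.
move=> ad a1.
pose As := [seq dil_mx b | b <- iota 0 d & coprime b d].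
have [P Pu /allP hP] : codiagonalizable As.
  apply/codiagonalizableP; split.
    move=> _ _ /mapP[b _ ->] /mapP[c _ ->].
    by rewrite /comm_mx !dil_mxM mulnC.
  by move=> _ /mapP[b + ->]; rewrite mem_filter => /andP[bd _]; exact: dil_mx_diag.
have eig b : coprime b d -> exists D : 'rV[C]_d, P *m dil_mx b = diag_mx D *m P.
  move=> bd; have hb : dil_mx b \in As.
    rewrite (@dil_mx_mod b (b %% d)) ?modn_mod //; apply/mapP; exists (b %% d)%N => //.
    by rewrite mem_filter coprime_modl bd mem_iota ltn_mod.
  have /diagonalizable_forPex[D /(simmxP Pu) h] := hP _ hb.
  by exists D.
have [D hD] : exists D : nat -> 'rV[C]_d, forall b, coprime b d ->
    P *m dil_mx b = diag_mx (D b) *m P.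
  have : forall b, exists Db : 'rV[C]_d, coprime b d -> P *m dil_mx b = diag_mx Db *m P.
    move=> b; have [bd|nbd] := boolP (coprime b d); last by exists 0.
    by have [Db h] := eig b bd; exists Db.
  by move/choice => [D hD]; exists D.
have ev (i : 'I_d) b k : coprime b d -> row i P 0 (inZp (b * k)) = D b 0 i * row i P 0 (inZp k).
  move=> bd; have /(congr1 (row i)) := hD b bd.
  rewrite !row_mul row_diag_mx -scalemxAl -rowE => /(congr1 (fun f : 'rV_d => f 0 (inZp k))).
  rewrite mul_dil_mx [in RHS]mxE => <-.
  by rewrite /= inZp_mul_mod.
have [i [hi1 hi2]] : exists i : 'I_d, row i P 0 (inZp 1) != 0 /\ D a 0 i != 1.
  apply: contrapT => hn.
  have h i : row i P 0 (inZp a) = row i P 0 (inZp 1).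
    rewrite -[in LHS](muln1 a) ev //.
    have [->|hi] := eqVneq (row i P 0 (inZp 1)) 0; first by rewrite mulr0.
    have [->|hi2] := eqVneq (D a 0 i) 1; first by rewrite mul1r.
    by case: hn; exists i.
  pose f : 'rV[C]_d := delta_mx 0 (inZp 1).
  have : f 0 (inZp a) = f 0 (inZp 1).
    have -> : f = (f *m invmx P) *m P by rewrite mulmxKV.
    rewrite !mxE; apply: eq_bigr => j _; congr (_ * _).
    by have := h j; rewrite !mxE.
  rewrite !mxE !eqxx /=.
  have -> : (inZp a == inZp 1 :> 'I_d) = false.
    by apply/eqP => /(congr1 val) /= e; move: a1; rewrite e eqxx.
  by move/eqP; rewrite eq_sym oner_eq0.
exists (row i P), (fun b => D b 0 i); split => //.
by move=> b k bd; exact: ev.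
Qed.

End Separation.

(** * Finiteness and orthogonality of characters *)

Section Characters.
Variables (R : realType) (d : nat).
Hypothesis d_gt0 : (0 < d)%N.
Local Notation C := (Cplx R).
Implicit Types (chi : int -> C) (a b z w : int).

Definition red z : nat := `|(z %% d%:Z)%Z|%N.

Lemma redE z : (red z)%:Z = (z %% d%:Z)%Z.
Proof. by rewrite /red gez0_abs // modz_ge0 // eqz_nat -lt0n. Qed.

Lemma red_coprime z : coprime (red z) d = coprimez z d%:Z.
Proof. by rewrite -[coprime _ _]/(coprimez (red z)%:Z d%:Z) redE /coprimez gcdz_modl. Qed.

Lemma red_nat (k : nat) : red k%:Z = (k %% d)%N.
Proof. by rewrite /red modz_nat. Qed.

Lemma redM z w : red (z * w) = (red z * red w %% d)%N.
Proof. by apply/eqP; rewrite -eqz_nat redE -modz_nat PoszM !redE modzMm. Qed.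

Lemma red_lt z : (red z < d)%N.
Proof. by rewrite -ltz_nat redE ltz_pmod. Qed.

Lemma Posz_exp (k n : nat) : (k ^ n)%N%:Z = k%:Z ^+ n.
Proof. by rewrite -natz natrX natz. Qed.

Lemma char_addM chi a k : is_dirichlet_char d chi -> chi (a + k * d%:Z) = chi a.
Proof.
case=> _ _ hp _.
have hn (n : nat) b : chi (b + n%:Z * d%:Z) = chi b.
  elim: n b => [|n IH] b; first by rewrite mul0r addr0.
  by rewrite -(IH b) -(hp (b + n%:Z * d%:Z)); congr chi; lia.
case: k => n; first exact: hn.
by rewrite -(hn n.+1 (a + _)); congr chi; rewrite NegzE; ring.
Qed.

Lemma char_red chi a : is_dirichlet_char d chi -> chi a = chi (red a)%:Z.
Proof.
by move=> h; rewrite [in LHS](divz_eq a d%:Z) addrC char_addM // redE.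
Qed.

Lemma char_eq_mod chi a b : is_dirichlet_char d chi -> (a = b %[mod d%:Z])%Z -> chi a = chi b.
Proof. by move=> h e; rewrite (char_red a h) (char_red b h) /red e. Qed.

Lemma char_eq0 chi a : is_dirichlet_char d chi -> ~~ coprimez a d%:Z -> chi a = 0.
Proof. by case=> _ _ _ h; apply: contraNeq => /h. Qed.

Lemma charX chi a n : is_dirichlet_char d chi -> chi (a ^+ n) = chi a ^+ n.
Proof.
by case=> h1 hM _ _; elim: n => [|n IH]; rewrite ?expr0 ?h1 // !exprS hM IH.
Qed.

Lemma char_totient chi a : is_dirichlet_char d chi -> coprimez a d%:Z ->
  chi a ^+ totient d = 1.
Proof.
move=> h ca; rewrite (char_red a h) -charX //.
have := @Euler_exp_totient (red a) d; rewrite red_coprime => /(_ ca) e.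
case: (h) => h1 _ _ _; rewrite -h1; apply: char_eq_mod => //.
by rewrite -[1]/(1%N%:Z) -Posz_exp !modz_nat e.
Qed.

Lemma char_norm chi a : is_dirichlet_char d chi -> coprimez a d%:Z -> `|chi a| = 1.
Proof.
move=> h ca; apply/eqP; rewrite -(@pexpr_eq1 _ _ (totient d)) ?totient_gt0 //.
by rewrite -normrX char_totient // normr1.
Qed.

Lemma char_conjM chi a : is_dirichlet_char d chi ->
  chi a * (chi a)^*%C = (coprimez a d%:Z)%:R.
Proof.
move=> h; have [ca|nca] := boolP (coprimez a d%:Z); last by rewrite char_eq0 // mul0r.
by rewrite -[LHS]sqr_normc char_norm // expr1n.
Qed.

Lemma char_norm_le1 chi a : is_dirichlet_char d chi -> `|chi a| <= 1.
Proof.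
move=> h; have [ca|nca] := boolP (coprimez a d%:Z); first by rewrite char_norm.
by rewrite char_eq0 // normr0.
Qed.

Lemma char_mul chi1 chi2 : is_dirichlet_char d chi1 -> is_dirichlet_char d chi2 ->
  is_dirichlet_char d (fun a => chi1 a * chi2 a).
Proof.
move=> [h1 hM hp h0] [k1 kM kp k0]; split.
- by rewrite h1 k1 mulr1.
- by move=> a b; rewrite hM kM mulrACA.
- by move=> a; rewrite hp kp.
- move=> a; rewrite mulf_eq0 negb_or; split => [/andP[/h0 //]|ca].
  by apply/andP; split; [apply/h0|apply/k0].
Qed.

Definition triv_char : int -> C := fun a => (coprimez a d%:Z)%:R.

Lemma triv_charP : is_dirichlet_char d triv_char.
Proof.
rewrite /triv_char; split.
- by rewrite /coprimez gcd1z.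
- by move=> a b; rewrite coprimezMl -natrM mulnb.
- by move=> a; rewrite /coprimez gcdzC gcdzDr gcdzC.
- by move=> a; case: coprimez; split => //; rewrite ?eqxx ?oner_eq0.
Qed.

(** An eigenfunction normalized at 1 and set to 0 off the units equals its eigenvalue [l] on units,
    and the eigenvalue relation makes it multiplicative. *)
Lemma char_separates a : coprimez a d%:Z -> (a != 1 %[mod d%:Z])%Z ->
  exists2 chi : int -> C, is_dirichlet_char d chi & chi a != 1.
Proof.
case: d d_gt0 red redE red_coprime red_nat redM => // n _ r rE rC rN rM ca a1.
have [p [l [p1 la hp]]] : exists (p : 'rV[C]_n.+1) (l : nat -> C), [/\ p 0 (inZp 1) != 0, l (r a) != 1 &
    forall b k : nat, coprime b n.+1 -> p 0 (inZp (b * k)) = l b * p 0 (inZp k)].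
  apply: separating_function; first by rewrite rC.
  apply: contraNneq a1 => e.
  by rewrite -(modz_mod a) -(rE a) -[1]/(1%N%:Z) !modz_nat e.
pose chi z := if coprimez z n.+1%:Z then p 0 (inZp (r z)) / p 0 (inZp 1) else 0.
have chiE z : coprimez z n.+1%:Z -> chi z = l (r z).
  move=> cz; rewrite /chi cz -[in LHS](muln1 (r z)) hp ?rC // mulfK //.
have inE k j : (k = j %[mod n.+1])%N -> (inZp k : 'I_n.+1) = inZp j.
  by move=> e; apply: val_inj.
exists chi; last by rewrite chiE.
split.
- by rewrite /chi /coprimez gcd1z /= -[1]/(1%N%:Z) rN (@inE _ 1%N) ?modn_mod // mulfV.
- move=> z w; have [cz|cz] := boolP (coprimez z n.+1%:Z); last first.
    by rewrite /chi coprimezMl (negbTE cz) mul0r.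
  have [cw|cw] := boolP (coprimez w n.+1%:Z); last first.
    by rewrite /chi coprimezMl (negbTE cw) andbF mulr0.
  rewrite /chi coprimezMl cz cw /= rM (@inE _ (r z * r w)%N) ?modn_mod // hp ?rC //.
  by rewrite -(chiE z cz) /chi cz mulrA.
- move=> z; rewrite /chi.
  have -> : r (z + n.+1%:Z) = r z by apply/eqP; rewrite -eqz_nat !rE modzDr.
  by rewrite /coprimez gcdzC gcdzDr gcdzC.
- move=> z; split; first by rewrite /chi; case: ifP => //; rewrite eqxx.
  move=> cz; rewrite /chi cz mulf_neq0 ?invr_eq0 //.
  rewrite -[r z]muln1 hp ?rC // mulf_neq0 //.
  (* A zero eigenvalue would give [p 1 = 0], since a positive power of [r z] is 1 modulo [n.+1]. *)
  apply: contra_neq p1 => l0.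
  have := @Euler_exp_totient (r z) n.+1; rewrite rC => /(_ cz) e.
  have t0 : (0 < totient n.+1)%N by rewrite totient_gt0.
  by rewrite -(inE _ _ e) -(prednK t0) expnS hp ?rC // l0 mul0r.
Qed.

(** A character is determined by its values at the [d] residues, each of which is 0 or a root of
    [X^(totient d) - 1]. *)
Lemma finite_dchars : finite_set (@dchars R d).
Proof.
have [r hr] := closed_field_poly_normal ('X^(totient d) - 1 : {poly C}).
have t0 : (0 < totient d)%N by rewrite totient_gt0.
rewrite lead_coefXnsubC // scale1r in hr.
pose h (g : {ffun 'I_d -> 'I_(size r).+1}) : int -> C := fun z =>
  if insub (red z) is Some i then nth 0 (0 :: r) (g i) else 0.
apply: (@sub_finite_set _ _ (h @` setT)); last exact/finite_image/finite_finset.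
move=> chi hchi.
have hi (i : 'I_d) : exists j : 'I_(size r).+1, nth 0 (0 :: r) j = chi (val i)%:Z.
  have : chi (val i)%:Z \in 0 :: r.
    rewrite inE; have [ci|/char_eq0 ->] := boolP (coprimez (val i)%:Z d%:Z); rewrite ?eqxx //.
    rewrite -root_prod_XsubC -hr /root !hornerE char_totient // subrr eqxx orbT //.
  move=> hin; have hl : (index (chi (val i)%:Z) (0%R :: r) < (size r).+1)%N by rewrite index_mem.
  by exists (Ordinal hl); rewrite nth_index.
have [g hg] := choice hi.
exists [ffun i => g i] => //.
apply/funext => z; rewrite /h; case: insubP => [i _ e|]; last by rewrite red_lt.
by rewrite ffunE hg e -char_red.
Qed.

Definition dchar_seq : seq (int -> C) := finmap.enum_fset (fset_set (@dchars R d)).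

Lemma dchar_seqP chi : reflect (is_dirichlet_char d chi) (chi \in dchar_seq).
Proof.
rewrite /dchar_seq in_fset_set; last exact: finite_dchars.
by apply: (iffP idP); rewrite inE.
Qed.

Lemma dchar_seq_uniq : uniq dchar_seq.
Proof. exact: finmap.fset_uniq. Qed.

(** Multiplication by [chi1] is injective on characters, as [chi1] does not vanish on units, hence
    permutes the finite list. *)
Lemma sum_dchars_mul (chi1 : int -> C) (F : (int -> C) -> C) : is_dirichlet_char d chi1 ->
  \sum_(chi <- dchar_seq) F (fun a => chi1 a * chi a) = \sum_(chi <- dchar_seq) F chi.
Proof.
move=> h1.
rewrite -(big_map (fun chi : int -> C => fun a => chi1 a * chi a) xpredT F).
apply: perm_big.
set s' := map _ _.
have us : uniq s'.
  rewrite map_inj_in_uniq; first exact: dchar_seq_uniq.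
  move=> chi chi' /dchar_seqP hc /dchar_seqP hc' e.
  apply/funext => a; have := congr1 (fun f => f a) e => /=.
  have [ca|nca] := boolP (coprimez a d%:Z); last by rewrite !(char_eq0 _ nca).
  by apply: mulfI; case: h1 => _ _ _ h; apply/h.
have ss : {subset s' <= dchar_seq}.
  by move=> _ /mapP[chi /dchar_seqP hc ->]; apply/dchar_seqP; exact: char_mul.
have [] := uniq_min_size us ss; first by rewrite size_map.
by move=> _ e; apply: uniq_perm => //; exact: dchar_seq_uniq.
Qed.

(** Multiplying the residues by a unit [b] with [chi b != 1] only permutes the terms, yet multiplies
    the sum by [chi b]. *)
Lemma sum_char chi : is_dirichlet_char d chi ->
  \sum_(i < d) chi (val i)%:Z = (totient d)%:R *+ (chi == triv_char).
Proof.
move=> h; have [->|ne] := eqVneq chi triv_char.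
  rewrite totient_count_coprime big_mkord natr_sum; apply: eq_bigr => i _.
  by rewrite /triv_char coprimezE /= coprime_sym.
have [b cb hb] : exists2 b, coprimez b d%:Z & chi b != 1.
  apply: contrapT => hn; case/eqP: ne; apply/funext => b.
  have [cb|ncb] := boolP (coprimez b d%:Z); last by rewrite !char_eq0 //; exact: triv_charP.
  rewrite /triv_char cb; apply: contrapT => /eqP hb; apply: hn; by exists b.
pose f (i : 'I_d) : 'I_d := Ordinal (red_lt (b * (val i)%:Z)).
have fi : injective f.
  move=> i j /(congr1 val) /= e; apply/val_inj/eqP; rewrite /= -eqz_nat.
  have : (b * (val i)%:Z == b * (val j)%:Z %[mod d%:Z])%Z by rewrite -!redE e.
  rewrite eqz_mod_dvd -mulrBr Gauss_dvdzr; last by rewrite coprimez_sym.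
  by rewrite -eqz_mod_dvd !modz_nat !modn_small ?ltn_ord.
have e : \sum_(i < d) chi (val i)%:Z = chi b * \sum_(i < d) chi (val i)%:Z.
  rewrite [LHS](reindex_inj fi) mulr_sumr; apply: eq_bigr => i _ /=.
  by rewrite -char_red //; case: h => _ hM _ _; rewrite hM.
apply/eqP; rewrite mulr0n; have /eqP := e.
rewrite -subr_eq0 -{1}[\sum_(i < d) _]mul1r -mulrBl mulf_eq0 subr_eq0 eq_sym (negbTE hb).
by [].
Qed.

(** Away from 1 a separating character kills the sum. At 1 it is the number of characters, not known
    beforehand; summing over all residues in both orders identifies it with [totient d]. *)
Lemma sum_dchars a :
  \sum_(chi <- dchar_seq) chi a = (totient d)%:R *+ (a == 1 %[mod d%:Z])%Z.
Proof.
have h0 b : (b != 1 %[mod d%:Z])%Z -> \sum_(chi <- dchar_seq) chi b = 0.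
  move=> b1; have [cb|ncb] := boolP (coprimez b d%:Z); last first.
    by rewrite big_seq big1 // => chi /dchar_seqP hc; rewrite char_eq0.
  have [chi1 h1 hb] := char_separates cb b1.
  have /eqP := sum_dchars_mul (fun chi => chi b) h1.
  rewrite -mulr_sumr -subr_eq0 -{2}[\sum_(i <- _) _]mul1r -mulrBl mulf_eq0 subr_eq0 (negbTE hb).
  by move/eqP.
have [a1|/h0 -> //] := eqVneq (a %% d%:Z)%Z (1 %% d%:Z)%Z.
have e1 b : (b = 1 %[mod d%:Z])%Z -> \sum_(chi <- dchar_seq) chi b = (size dchar_seq)%:R.
  move=> b1; rewrite big_seq (eq_bigr (fun=> 1)).
    by rewrite -big_seq big_const_seq count_predT iter_addr addr0.
  move=> chi /dchar_seqP hc; rewrite (char_eq_mod hc b1); by case: hc.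
have : \sum_(i < d) \sum_(chi <- dchar_seq) chi (val i)%:Z = (totient d)%:R.
  rewrite exchange_big /= big_seq.
  rewrite (eq_bigr (fun chi => (totient d)%:R *+ (chi == triv_char))); last first.
    by move=> chi /dchar_seqP; exact: sum_char.
  rewrite -big_seq (bigD1_seq triv_char) /=; [|by apply/dchar_seqP; exact: triv_charP|exact: dchar_seq_uniq].
  by rewrite eqxx mulr1n big1 ?addr0 // => chi /negbTE ->.
pose i1 : 'I_d := Ordinal (red_lt 1).
rewrite (bigD1 i1) //= e1 /=; last by rewrite redE modz_mod.
rewrite big1 ?addr0 => [<-|i ii1]; first by rewrite e1.
apply: h0; apply: contraNneq ii1 => e; apply/eqP/val_inj/eqP; rewrite /= -eqz_nat redE -e.
by rewrite modz_nat modn_small.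
Qed.

End Characters.

Lemma cvgn_sum (K : numFieldType) (V : normedModType K) (I : eqType) (r : seq I) (P : pred I)
    (u : I -> nat -> V) (l : I -> V) :
  (forall i, i \in r -> P i -> u i n @[n --> \oo] --> l i) ->
  \sum_(i <- r | P i) u i n @[n --> \oo] --> \sum_(i <- r | P i) l i.
Proof.
elim: r => [|i r IH] h.
  under eq_fun do rewrite big_nil.
  by rewrite big_nil; exact: cvg_cst.
under eq_fun do rewrite big_cons.
have {}IH : \sum_(i <- r | P i) u i n @[n --> \oo] --> \sum_(i <- r | P i) l i.
  by apply: IH => j jr; apply: h; rewrite inE jr orbT.
rewrite big_cons; case: ifP => // Pi; apply: cvgD => //.
by apply: h => //; rewrite mem_head.
Qed.

(** * Limits of complex sequences *)

Section ComplexBasics.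
Variable R : realType.
Local Notation C := (Cplx R).
Local Open Scope complex_scope.

Lemma normC_real (x : R) : `|x%:C : C| = (`|x|)%:C.
Proof. by rewrite normc_def /= expr0n addr0 sqrtr_sqr. Qed.

Lemma cvgC (u : nat -> C) (a b : R) :
  Re (u n) @[n --> \oo] --> a -> Im (u n) @[n --> \oo] --> b ->
  u n @[n --> \oo] --> (a +i* b : C).
Proof.
move=> ha hb; apply/cvgrPdist_lt => e e0.
have [r r0 ->] : exists2 r : R, 0 < r & e = r%:C.
  move: e e0 => [er ei]; rewrite ltcE /= => /andP[/eqP -> er0]; by exists er.
have r2 : 0 < r / 2 by apply: divr_gt0.
move/cvgrPdist_lt: ha => /(_ _ r2) ha.
move/cvgrPdist_lt: hb => /(_ _ r2) hb.
near=> n.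
have h1 : `|a - Re (u n)| < r / 2 by near: n.
have h2 : `|b - Im (u n)| < r / 2 by near: n.
have -> : (a +i* b : C) - u n = (a - Re (u n))%:C + 'i * (b - Im (u n))%:C.
  by case: (u n) => x y; simpc.
apply: (le_lt_trans (ler_normD _ _)).
have -> : `|'i * (b - Im (u n))%:C : C| = (`|b - Im (u n)|)%:C.
  by rewrite normrM normC_real normc_def /= expr0n expr1n add0r sqrtr1 mul1r.
rewrite normC_real -[X in X < _]rmorphD /= ltcR.
lra.
Unshelve. all: by end_near.
Qed.

Lemma cvgCr (u : nat -> R) (a : R) :
  u n @[n --> \oo] --> a -> (u n)%:C @[n --> \oo] --> (a%:C : C).
Proof. by move=> h; apply: (@cvgC (fun n => (u n)%:C)) => //=; exact: cvg_cst. Qed.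

Lemma limC (u : nat -> C) (l : C) : u n @[n --> \oo] --> l -> limn u = l.
Proof. by move=> h; apply: (cvg_lim _ h); exact: (@norm_hausdorff _ C^o). Qed.

Lemma cvgC_sum (I : eqType) (r : seq I) (P : pred I) (u : I -> nat -> C) (l : I -> C) :
  (forall i, i \in r -> P i -> u i n @[n --> \oo] --> l i) ->
  \sum_(i <- r | P i) u i n @[n --> \oo] --> \sum_(i <- r | P i) l i.
Proof. exact: (@cvgn_sum C C^o I r P u l). Qed.

Lemma cvgC_mull (c : C) (u : nat -> C) (l : C) :
  u n @[n --> \oo] --> l -> c * u n @[n --> \oo] --> c * l.
Proof. by move=> h; apply: cvgMr. Qed.

Lemma cvg_subseq_nat (T : topologicalType) (u : nat -> T) (l : T) (f : nat -> nat) :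
  (forall n, (n <= f n)%N) -> u n @[n --> \oo] --> l -> u (f n) @[n --> \oo] --> l.
Proof.
move=> hf; apply: cvg_comp => A [N _ hN]; exists N => // n /= Nn.
by apply: hN => /=; exact: leq_trans (hf n).
Qed.

Lemma norm_Re_le (z : C) : `|z| <= 1 -> `|Re z| <= 1.
Proof.
move=> h; have := le_trans (normc_ge_Re z) h.
by rewrite -[1]/(1%:C) lecR.
Qed.

Lemma norm_Im_le (z : C) : `|z| <= 1 -> `|Im z| <= 1.
Proof.
move=> h; rewrite -[Im z]opprK -ReiNIm normrN; apply: norm_Re_le.
by rewrite normrM [`|'i%C|]normc_def /= expr0n expr1n add0r sqrtr1 mulr1.
Qed.

Lemma Re_sum (I : Type) (r : seq I) (P : pred I) (F : I -> C) :
  Re (\sum_(i <- r | P i) F i) = \sum_(i <- r | P i) Re (F i).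
Proof. by apply: (big_morph (@Re R)) => // -[x y] [x' y']. Qed.

Lemma Im_sum (I : Type) (r : seq I) (P : pred I) (F : I -> C) :
  Im (\sum_(i <- r | P i) F i) = \sum_(i <- r | P i) Im (F i).
Proof. by apply: (big_morph (@Im R)) => // -[x y] [x' y']. Qed.

Lemma divC_nat (z : C) n s : z / n%:R ^+ s = (Re z / n%:R ^+ s) +i* (Im z / n%:R ^+ s).
Proof.
have -> : (n%:R ^+ s : C)^-1 = ((n%:R ^+ s)^-1 : R)%:C.
  by rewrite fmorphV rmorphXn /= rmorph_nat.
by case: z => x y; simpc.
Qed.

Lemma cvg_Lser d (chi : int -> C) s : (0 < d)%N -> is_dirichlet_char d chi -> (1 < s)%N ->
  \sum_(1 <= n < N) chi n%:Z / n%:R ^+ s @[N --> \oo] --> Lser s chi.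
Proof.
move=> d0 h s1.
pose u N : C := \sum_(1 <= n < N) chi n%:Z / n%:R ^+ s.
have hn n : `|chi n%:Z| <= 1 := char_norm_le1 d0 n h.
have c1 : cvgn (fun N => Re (u N)).
  rewrite (_ : (fun N => Re (u N)) = fun N => \sum_(1 <= n < N) Re (chi n%:Z) / n%:R ^+ s).
    exact: (cvg_bounded_dirichlet s1 (fun n => norm_Re_le (hn n))).
  by apply/funext => N; rewrite Re_sum; apply: eq_bigr => i _; rewrite divC_nat.
have c2 : cvgn (fun N => Im (u N)).
  rewrite (_ : (fun N => Im (u N)) = fun N => \sum_(1 <= n < N) Im (chi n%:Z) / n%:R ^+ s).
    exact: (cvg_bounded_dirichlet s1 (fun n => norm_Im_le (hn n))).
  by apply/funext => N; rewrite Im_sum; apply: eq_bigr => i _; rewrite divC_nat.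
have hu := cvgC c1 c2.
by rewrite /Lser (limC hu).
Qed.

End ComplexBasics.

(** * Exponential sums *)

Section Exponentials.
Variable R : realType.
Local Notation C := (Cplx R).
Local Open Scope complex_scope.
Implicit Types (x y : R) (d m n : nat) (z w : int).

Lemma expiD x y : expi (x + y) = expi x * expi y :> C.
Proof. by rewrite /expi cosD sinD; simpc; congr (_ +i* _); rewrite addrC. Qed.

Lemma expi0 : expi 0 = 1 :> C.
Proof. by rewrite /expi cos0 sin0. Qed.

Lemma expi_2pi_nat n : expi (2 * pi * n%:R) = 1 :> C.
Proof.
elim: n => [|n IH]; first by rewrite mulr0 expi0.
rewrite -[n.+1%:R]natr1 mulrDr mulr1 expiD IH mul1r /expi.
by rewrite mulr_natl cos2pi sin2pi.
Qed.

Definition ee d z : C := expi (2 * pi * z%:~R / d%:R).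

Lemma eeD d z w : ee d (z + w) = ee d z * ee d w.
Proof. by rewrite /ee -expiD intrD; congr expi; ring. Qed.

Lemma ee0 d : ee d 0 = 1.
Proof. by rewrite /ee mulr0 mul0r expi0. Qed.

Lemma eeX d z n : ee d (n%:Z * z) = ee d z ^+ n.
Proof.
elim: n => [|n IH]; first by rewrite mul0r ee0.
by rewrite exprS -IH -eeD; congr ee; rewrite intS mulrDl mul1r.
Qed.

Lemma ee_modulus d n : (0 < d)%N -> ee d (n%:Z * d%:Z) = 1.
Proof.
move=> d0; rewrite /ee -[RHS](expi_2pi_nat n); congr expi.
by rewrite intrM -!pmulrn; field; rewrite pnatr_eq0 -lt0n.
Qed.

Lemma ee_red d z : (0 < d)%N -> ee d z = ee d (red d z)%:Z.
Proof.
move=> d0; rewrite [in LHS](divz_eq z d%:Z) eeD redE //.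
suff -> : ee d ((z %/ d%:Z)%Z * d%:Z) = 1 by rewrite mul1r.
case: (z %/ d%:Z)%Z => n; first exact: ee_modulus.
have := ee0 d; rewrite -(addNr (n.+1%:Z * d%:Z)) eeD ee_modulus // mulr1 => <-.
by rewrite NegzE mulNr.
Qed.

Lemma ee_eq_mod d z w : (0 < d)%N -> (z = w %[mod d%:Z])%Z -> ee d z = ee d w.
Proof. by move=> d0 e; rewrite (ee_red z d0) (ee_red w d0) /red e. Qed.

(** For [0 < k < d], the real part of [e(k / d) = 1] would force [sin(pi k / d) = 0], at an angle
    strictly between 0 and [pi]. *)
Lemma ee_neq1 d z : (0 < d)%N -> ~~ (d%:Z %| z)%Z -> ee d z != 1.
Proof.
move=> d0 dz; rewrite ee_red //.
have k0 : (0 < red d z)%N.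
  rewrite lt0n; apply: contra dz => /eqP e.
  by apply/dvdz_mod0P; rewrite -redE // e.
have kd := red_lt d0 z; set k := red d z in k0 kd *.
have dp : 0 < d%:R :> R by rewrite ltr0n.
apply/negP => /eqP/(congr1 (fun c : C => Re c)) /=.
rewrite -pmulrn.
have -> : 2 * pi * k%:R / d%:R = (pi * k%:R / d%:R) *+ 2 :> R by rewrite -mulr_natl; ring.
rewrite cos_mulr2n => h.
have s0 : 0 < sin (pi * k%:R / d%:R : R).
  apply: sin_gt0_pi; apply/andP; split.
    by rewrite divr_gt0 // mulr_gt0 ?pi_gt0 ?ltr0n.
  by rewrite ltr_pdivrMr // ltr_pM2l ?pi_gt0 // ltr_nat.
have : 0 < sin (pi * k%:R / d%:R : R) ^+ 2 by rewrite exprn_gt0.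
rewrite sin2cos2.
have : cos (pi * k%:R / d%:R : R) ^+ 2 *+ 2 - 1 = 1 by exact: h.
by rewrite -mulr_natl; lra.
Qed.

Lemma sum_ee d z : (0 < d)%N ->
  \sum_(i < d) ee d ((val i)%:Z * z) = d%:R *+ (d%:Z %| z)%Z.
Proof.
move=> d0; rewrite (eq_bigr (fun i : 'I_d => ee d z ^+ i)); last by move=> i _; rewrite eeX.
have [dz|ndz] := boolP (d%:Z %| z)%Z.
  have -> : ee d z = 1.
    by rewrite (@ee_eq_mod d z 0) ?ee0 // (dvdz_mod0P dz) mod0z.
  rewrite (eq_bigr (fun=> 1)); last by move=> i _; rewrite expr1n.
  by rewrite sumr_const card_ord.
have h := subrX1 (ee d z) d.
rewrite -eeX mulrC -[z * _]/(z * d%:Z) in h.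
have e1 : ee d (d%:Z * z) = 1.
  by rewrite (@ee_eq_mod d _ 0) ?ee0 // mod0z; apply/dvdz_mod0P/dvdz_mulr.
move: h; rewrite mulrC e1 subrr => /esym/eqP; rewrite mulf_eq0 subr_eq0.
by rewrite (negbTE (ee_neq1 d0 ndz)) orFb ?orbF => /eqP.
Qed.

Lemma ee_addN d z : ee d z + ee d (- z) = 2 * (cos (2 * pi * z%:~R / d%:R))%:C.
Proof. by rewrite /ee intrN !mulrN mulNr /expi cosN sinN; simpc; congr (_ +i* _); ring. Qed.

Lemma ee_subN d z : ee d z - ee d (- z) = 2 * ('i * (sin (2 * pi * z%:~R / d%:R))%:C).
Proof. by rewrite /ee intrN !mulrN mulNr /expi cosN sinN; simpc; congr (_ +i* _); ring. Qed.

Lemma gauss_sumE d (chi : int -> C) :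
  gauss_sum d chi = \sum_(i < d) chi (val i)%:Z * ee d (val i)%:Z.
Proof. by rewrite /gauss_sum big_mkord. Qed.

End Exponentials.

(** * Expansion of additive characters in multiplicative ones *)

Section GaussExpansion.
Variables (R : realType) (d : nat).
Hypothesis d_gt0 : (0 < d)%N.
Local Notation C := (Cplx R).
Local Notation s := (dchar_seq R d).
Local Open Scope complex_scope.

(** On units, [conj_char chi b] is the value of [chi] at the inverse [b^(totient d - 1)], so this is
    [sum_dchars] at [a / b]. *)
Lemma sum_dchars_conj (a b : int) : coprimez a d%:Z ->
  \sum_(chi <- s) chi a * conj_char chi b = (totient d)%:R *+ (a == b %[mod d%:Z])%Z.
Proof.
move=> ca; have [cb|ncb] := boolP (coprimez b d%:Z); last first.
  have -> : (a == b %[mod d%:Z])%Z = false.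
    apply: contraNF ncb => /eqP e; move: ca; rewrite -!(red_coprime d_gt0).
    by rewrite /red e.
  rewrite big_seq big1 // => chi /(dchar_seqP d_gt0) h.
  by rewrite /conj_char (char_eq0 h ncb) conjc0 mulr0.
have t0 : (0 < totient d)%N by rewrite totient_gt0.
pose b' := b ^+ (totient d).-1.
have bb' (chi : int -> C) : is_dirichlet_char d chi -> conj_char chi b = chi b'.
  move=> h; have /mulfI : chi b != 0 by case: h => _ _ _ h; apply/h.
  apply; rewrite /conj_char (char_conjM _ b h) // cb.
  by rewrite (charX _ _ h) -exprS prednK // char_totient.
rewrite big_seq (eq_bigr (fun chi : int -> C => chi (a * b'))); last first.
  by move=> chi /(dchar_seqP d_gt0) h; rewrite bb' //; case: h => _ -> _ _.
rewrite -big_seq sum_dchars //; congr (_ *+ nat_of_bool _).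
have e1 : (b' * b = 1 %[mod d%:Z])%Z.
  rewrite /b' -exprSr prednK //.
  have := @Euler_exp_totient (red d b) d; rewrite red_coprime // => /(_ cb) e.
  apply/eqP; rewrite -modzXm -(redE d_gt0 b) -Posz_exp !modz_nat e.
  by rewrite -modz_nat.
have cb' : coprimez d%:Z b by rewrite coprimez_sym.
rewrite [LHS]eqz_mod_dvd -[LHS](Gauss_dvdzl _ cb') mulrBl mul1r.
by rewrite -eqz_mod_dvd -mulrA -modzMmr e1 modzMmr mulr1.
Qed.

Lemma gauss_expand (z : int) : coprimez z d%:Z ->
  \sum_(chi <- s) gauss_sum d (conj_char chi) * chi z = (totient d)%:R * ee R d z.
Proof.
move=> cz.
under eq_bigr do rewrite gauss_sumE mulr_suml.
rewrite exchange_big /=.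
rewrite (eq_bigr (fun i : 'I_d => ((totient d)%:R *+ (z == (val i)%:Z %[mod d%:Z])%Z) * ee R d (val i)%:Z)); last first.
  move=> i _; rewrite -sum_dchars_conj // mulr_suml; apply: eq_bigr => chi _.
  by rewrite mulrC mulrA.
rewrite (bigD1 (Ordinal (red_lt d_gt0 z))) //= redE // modz_mod eqxx mulr1n.
rewrite -redE // -ee_red // big1 ?addr0 // => i hi.
case: eqVneq => [e|]; last by rewrite mul0r.
by case/eqP: hi; apply/val_inj/eqP; rewrite /= -eqz_nat e modz_nat modn_small ?ltn_ord.
Qed.

Lemma char_N1 (chi : int -> C) : is_dirichlet_char d chi -> chi (-1) = 1 \/ chi (-1) = -1.
Proof.
move=> [h1 hM _ _]; have : chi (-1) * chi (-1) = 1 by rewrite -hM -h1.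
by rewrite -expr2 => /eqP; rewrite sqrf_eq1 => /orP[] /eqP; [left|right].
Qed.

(** Subtracting the expansion at [- z] doubles the odd characters and cancels the even ones; adding
    it does the opposite in [gauss_expand_even]. *)
Lemma gauss_expand_odd (z : int) : coprimez z d%:Z ->
  \sum_(chi <- s | chi (-1) == -1) gauss_sum d (conj_char chi) * chi z =
  (totient d)%:R * ('i * (sin (2 * pi * z%:~R / d%:R))%:C).
Proof.
move=> cz; have cNz : coprimez (- z) d%:Z by rewrite coprimez_sym coprimezN coprimez_sym.
have two : (2 : C) != 0 by rewrite pnatr_eq0.
apply: (mulfI two); rewrite [RHS]mulrCA -ee_subN mulrBr -!gauss_expand //.
rewrite mulr_sumr -sumrB [LHS]big_seq_cond [RHS]big_seq [RHS](bigID (fun chi : int -> C => chi (-1) == -1)) /=.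
rewrite [X in _ = _ + X]big1 ?addr0.
  apply: eq_bigr => chi /andP[/(dchar_seqP d_gt0)[_ hM _ _] /eqP h].
  by rewrite -(mulN1r z) hM h; ring.
move=> chi /andP[/(dchar_seqP d_gt0) hc /eqP h].
have [h1|//] := char_N1 hc; case: hc => _ hM _ _.
by rewrite -(mulN1r z) hM h1 mul1r subrr.
Qed.

Lemma gauss_expand_even (z : int) : coprimez z d%:Z ->
  \sum_(chi <- s | chi (-1) == 1) gauss_sum d (conj_char chi) * chi z =
  (totient d)%:R * (cos (2 * pi * z%:~R / d%:R))%:C.
Proof.
move=> cz; have cNz : coprimez (- z) d%:Z by rewrite coprimez_sym coprimezN coprimez_sym.
have two : (2 : C) != 0 by rewrite pnatr_eq0.
apply: (mulfI two); rewrite [RHS]mulrCA -ee_addN mulrDr -!gauss_expand //.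
rewrite mulr_sumr -big_split [LHS]big_seq_cond [RHS]big_seq [RHS](bigID (fun chi : int -> C => chi (-1) == 1)) /=.
rewrite [X in _ = _ + X]big1 ?addr0.
  apply: eq_bigr => chi /andP[/(dchar_seqP d_gt0)[_ hM _ _] /eqP h].
  by rewrite -(mulN1r z) hM h; ring.
move=> chi /andP[/(dchar_seqP d_gt0) hc /eqP h].
have [//|h1] := char_N1 hc; case: hc => _ hM _ _.
by rewrite -(mulN1r z) hM h1; ring.
Qed.

End GaussExpansion.

(** * Lifting units and regrouping sums *)

Lemma coprime_lift (m d a : nat) : (0 < m)%N -> (0 < a)%N -> coprime a d ->
  exists t, coprime (a + d * t) m.
Proof.
move=> m0 a0 ad; exists (m`_(\pi(a)^'))%N.
(* [t] is the part of [m] prime to [a]: a prime factor of [m] divides exactly one of [a] and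
   [d * t], hence not their sum. *)
set t := (m`_ _)%N.
rewrite coprime_has_primes ?addn_gt0 ?a0 //; apply/hasPn => p; rewrite mem_primes => /and3P[pp _ pm].
rewrite mem_primes addn_gt0 a0 pp /=; apply/negP => pat.
have [pa|npa] := boolP (p %| a)%N.
  have : (p %| d * t)%N by rewrite -(dvdn_addr _ pa).
  rewrite Euclid_dvdM // => /orP[pd|pt].
    by have := dvdn_gcd p a d; rewrite pa pd (eqP ad) dvdn1 => /eqP e; rewrite e in pp.
  have : p \in \pi(t) by rewrite mem_primes pp part_gt0.
  rewrite pi_of_part // inE /= => /andP[_].
  by rewrite inE /= mem_primes pp a0 pa.
have pt : (p %| t)%N.
  have : p \in \pi(t).
    by rewrite pi_of_part // inE /= mem_primes pp m0 pm /= inE /= mem_primes pp a0 (negbTE npa).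
  by rewrite mem_primes => /and3P[].
by move: npa; rewrite -(dvdn_addl _ (dvdn_mull d pt)) pat.
Qed.

Lemma coprimez_lift (m d : nat) (a : int) : (0 < m)%N -> (0 < d)%N -> coprimez a d%:Z ->
  exists2 b : int, coprimez b m%:Z & (b = a %[mod d%:Z])%Z.
Proof.
move=> m0 d0 ad.
(* Adding [d] keeps the representative positive, as [coprime_lift] requires: [red d a] is 0 when
   [d = 1]. *)
have ad' : coprime (red d a + d) d by rewrite coprime_sym /coprime gcdnDr -/(coprime _ _) coprime_sym red_coprime.
have [|t ht] := @coprime_lift m d _ m0 _ ad'; first by rewrite addn_gt0 d0 orbT.
exists (red d a + d + d * t)%N%:Z => //.
rewrite !PoszD PoszM redE //.
have -> : (a %% d%:Z)%Z + d%:Z + d%:Z * t%:Z = (1 + t%:Z) * d%:Z + (a %% d%:Z)%Z by ring.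
by rewrite modzMDl modz_mod.
Qed.

Lemma sum_even_nat_fold (V : zmodType) (m : nat) (F : nat -> V) : (0 < m)%N ->
  (forall a, (0 < a < m)%N -> F (m - a)%N = F a) ->
  (forall a, (2 * a = m)%N -> F a = 0) ->
  \sum_(1 <= a < m) F a = (\sum_(1 <= a < m | (2 * a < m)%N) F a) *+ 2.
Proof.
move=> m0 Fs Fh; rewrite (bigID (fun a => (2 * a < m)%N)) /= mulr2n; congr (_ + _).
rewrite big_nat_rev /= [LHS]big_nat_cond [RHS]big_nat_cond.
rewrite (bigID (fun a => (2 * a == m)%N)) /= big1 ?add0r.
  apply: eq_big => [a|a /andP[/andP[/andP[a1 am] h1] h2]].
    by apply/idP/idP; lia.
  by rewrite add1n subSS; apply: Fs; lia.
move=> a /andP[/andP[/andP[a1 am] _] /eqP e].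
by rewrite add1n subSS (_ : m - a = a)%N; [exact: Fh | lia].
Qed.

Lemma sum_multiples (V : zmodType) (e L : nat) (P : pred nat) (g : nat -> V) : (0 < e)%N ->
  (forall n, P n -> (e %| n)%N) ->
  \sum_(1 <= n < (e * L).+1 | P n) g n = \sum_(1 <= k < L.+1 | P (e * k)%N) g (e * k)%N.
Proof.
move=> e0 hP; elim: L => [|L IH]; first by rewrite muln0 !big_geq.
have le1 : (e * L < e * L.+1)%N by rewrite ltn_pmul2l.
rewrite (@big_cat_nat _ _ _ (e * L).+1) //=; last by apply: ltnW.
rewrite IH [RHS]big_mkcond big_nat_recr //= -big_mkcond /=; congr (_ + _).
rewrite big_mkcond big_nat_recr //= big_nat big1 ?add0r // => n /andP[h1 h2].
case: ifP => // /hP /dvdnP[q hq].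
have h3 : (L < q)%N by rewrite -(ltn_pmul2l e0) [(e * q)%N]mulnC -hq.
have h4 : (q < L.+1)%N by rewrite -(ltn_pmul2l e0) [(e * q)%N]mulnC -hq.
lia.
Qed.

(** The index [d] is [m / gcd(n, m)]. A cutoff at a multiple of [m] makes each inner range end
    exactly at [d * K]. *)
Lemma sum_regroup (V : zmodType) (m K : nat) (g : nat -> V) : (0 < m)%N ->
  \sum_(1 <= n < (m * K).+1) g n =
  \sum_(d <- divisors m) \sum_(1 <= k < (d * K).+1 | coprime k d) g (m %/ d * k)%N.
Proof.
move=> m0.
pose c n := (m %/ gcdn n m)%N.
have cd n : c n \in divisors m.
  by rewrite -dvdn_divisors // /c; apply: dvdn_div; exact: dvdn_gcdr.
transitivity (\sum_(1 <= n < (m * K).+1) \sum_(d <- divisors m | d == c n) g n).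
  apply: eq_bigr => n _.
  rewrite -big_filter filter_pred1_uniq ?divisors_uniq // big_seq1 //.
rewrite (exchange_big_dep xpredT) //= big_seq [RHS]big_seq; apply: eq_bigr => d.
rewrite -dvdn_divisors // => dm.
have d0 : (0 < d)%N by apply: dvdn_gt0 dm.
have e0 : (0 < m %/ d)%N by rewrite divn_gt0 // dvdn_leq.
have em : (m %/ d * d = m)%N by apply: divnK.
have hc n : (d == c n) = (gcdn n m == m %/ d)%N.
  have gm : (gcdn n m %| m)%N := dvdn_gcdr n m.
  have g0 : (0 < gcdn n m)%N by rewrite gcdn_gt0 m0 orbT.
  apply/eqP/eqP => h.
    by apply/eqP; rewrite -(eqn_pmul2r d0) em h /c mulnC divnK.
  by rewrite /c h; apply/eqP; rewrite -(eqn_pmul2r e0) [X in _ == X]divnK ?dvdn_div // mulnC em.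
rewrite -{1}em -mulnA (sum_multiples _ _ e0); last first.
  by move=> n; rewrite hc => /eqP <-; exact: dvdn_gcdl.
apply: eq_bigl => k; rewrite hc -{2}em -muln_gcdr -{2}[(m %/ d)%N]muln1 eqn_pmul2l //.
Qed.

(** * Gauss sums of primitive characters *)

Section Primitive.
Variables (R : realType) (m : nat) (psi : int -> Cplx R).
Hypothesis m_gt0 : (0 < m)%N.
Local Notation C := (Cplx R).
Hypothesis psi_prim : primitive_char m psi.

Let psiP : is_dirichlet_char m psi. Proof. by case: psi_prim. Qed.

(** The character modulo [d] takes at [a] the value of [psi] at any lift of [a] prime to [m]; the
    triviality assumption makes this independent of the lift, hence multiplicative. *)
Lemma induced_by_of_trivial (d : nat) : (0 < d)%N -> (d %| m)%N ->
  (forall c : int, coprimez c m%:Z -> (c = 1 %[mod d%:Z])%Z -> psi c = 1) ->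
  induced_by m d psi.
Proof.
move=> d0 dm H.
have t0 : (0 < totient m)%N by rewrite totient_gt0.
case: (psiP) => psi1 psiM _ psi0.
have modd (a b : int) : (a = b %[mod m%:Z])%Z -> (a = b %[mod d%:Z])%Z.
  move=> /eqP; rewrite eqz_mod_dvd => h; apply/eqP; rewrite eqz_mod_dvd.
  by apply: dvdz_trans h.
have cop (a : int) : coprimez a m%:Z -> coprimez a d%:Z by apply: coprimez_dvdr.
have K b b' : coprimez b m%:Z -> coprimez b' m%:Z -> (b = b' %[mod d%:Z])%Z -> psi b = psi b'.
  move=> cb cb' e.
  have h1 : psi b' ^+ totient m = 1 by apply: char_totient.
  have : psi (b * b' ^+ (totient m).-1) = 1.
    apply: H; first by rewrite coprimezMl cb coprimezXl.
    rewrite -modzMml e modzMml -exprS prednK //; apply: modd.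
    have := @Euler_exp_totient (red m b') m; rewrite red_coprime // => /(_ cb') e'.
    by apply/eqP; rewrite -modzXm -(redE m_gt0 b') -Posz_exp !modz_nat e' -modz_nat.
  rewrite psiM (charX _ _ psiP) => /(congr1 (fun c => psi b' * c)).
  by rewrite mulrCA -exprS prednK // h1 !mulr1.
have [L hL] : exists L : int -> int, forall a, coprimez a d%:Z ->
    coprimez (L a) m%:Z /\ (L a = a %[mod d%:Z])%Z.
  have : forall a, exists b : int, coprimez a d%:Z -> coprimez b m%:Z /\ (b = a %[mod d%:Z])%Z.
    move=> a; have [ca|_] := boolP (coprimez a d%:Z); last by exists 0.
    by have [b h1 h2] := coprimez_lift m_gt0 d0 ca; exists b.
  by move/choice => [L hL]; exists L.
exists (fun a => if coprimez a d%:Z then psi (L a) else 0); split; last first.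
  move=> a ca; rewrite (cop _ ca); have [h1 h2] := hL a (cop _ ca).
  by apply: K.
have c1 : coprimez 1 m%:Z by rewrite /coprimez gcd1z.
split.
- have h := hL 1 (cop _ c1); rewrite (cop _ c1) -psi1; apply: K => //; by case: h.
- move=> a b; rewrite coprimezMl.
  have [ca|ca] := boolP (coprimez a d%:Z); last by rewrite mul0r.
  have [cb|cb] := boolP (coprimez b d%:Z); last by rewrite mulr0.
  have [a1 a2] := hL a ca; have [b1 b2] := hL b cb.
  have [ab1 ab2] : coprimez (L (a * b)) m%:Z /\ (L (a * b) = a * b %[mod d%:Z])%Z.
    by apply: hL; rewrite coprimezMl ca.
  rewrite /= -psiM; apply: K => //; first by rewrite coprimezMl a1.
  by rewrite ab2 -modzMml -a2 modzMml -modzMmr -b2 modzMmr.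
- move=> a; have -> : coprimez (a + d%:Z) d%:Z = coprimez a d%:Z.
    by rewrite /coprimez gcdzC gcdzDr gcdzC.
  have [ca|//] := boolP (coprimez a d%:Z).
  have ca' : coprimez (a + d%:Z) d%:Z by rewrite /coprimez gcdzC gcdzDr gcdzC.
  have [a1 a2] := hL a ca; have [b1 b2] := hL _ ca'.
  by apply: K => //; rewrite a2 b2 modzDr.
- move=> a; have [ca|ca] := boolP (coprimez a d%:Z); last by split => //; rewrite eqxx.
  by split => // _; apply/psi0; case: (hL a ca).
Qed.

(** The only unit modulo 2 is 1, so a character modulo 2 is induced from modulus 1. The case matters
    when sums are folded at [m / 2], where the midpoint would be a unit. *)
Lemma primitive_gt2 : (1 < m)%N -> (2 < m)%N.
Proof.
move=> m1; rewrite ltn_neqAle m1 andbT; apply/eqP => m2.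
case: psi_prim => _ /(_ 1%N (dvd1n _) m1); apply.
apply: induced_by_of_trivial => // c cm _.
case: (psiP) => psi1 _ _ _; rewrite -psi1; apply: char_eq_mod psiP _ => //.
have : coprime (red m c) m by rewrite red_coprime.
have := red_lt m_gt0 c; rewrite -[(c %% _)%Z]redE // -m2.
by case: (red 2 c) => [|[|]].
Qed.

(** Units congruent to 1 modulo [m / gcd(n, m)] fix [n] modulo [m]; were [psi] trivial on all of
    them, it would be induced from this proper divisor. *)
Lemma primitive_witness (n : int) : ~~ coprimez n m%:Z ->
  exists c : int, [/\ coprimez c m%:Z, (c * n = n %[mod m%:Z])%Z & psi c != 1].
Proof.
move=> nc; apply: contrapT => hn.
pose g := gcdn `|n| m.
have gm : (g %| m)%N := dvdn_gcdr _ _.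
have g0 : (0 < g)%N by rewrite gcdn_gt0 m_gt0 orbT.
have g1 : (1 < g)%N by rewrite ltn_neqAle g0 andbT eq_sym.
have d0 : (0 < m %/ g)%N by rewrite divn_gt0 // dvdn_leq.
case: psi_prim => _ /(_ (m %/ g)%N); apply; [exact: dvdn_div|exact: ltn_Pdiv|].
apply: induced_by_of_trivial => //; first exact: dvdn_div.
move=> c cm c1; apply: contrapT => /eqP cn; apply: hn; exists c; split => //.
apply/eqP; rewrite eqz_mod_dvd -{2}[n]mul1r -mulrBl.
move/eqP: c1; rewrite eqz_mod_dvd !dvdzE abszM => h.
by rewrite -(divnK gm); apply: dvdn_mul => //; exact: dvdn_gcdl.
Qed.

Lemma sum_reindex_mul (F : int -> C) (c : int) : coprimez c m%:Z ->
  (forall z, F z = F (red m z)%:Z) ->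
  \sum_(i < m) F (c * (val i)%:Z) = \sum_(i < m) F (val i)%:Z.
Proof.
move=> cc hF.
pose f (i : 'I_m) : 'I_m := Ordinal (red_lt m_gt0 (c * (val i)%:Z)).
have fi : injective f.
  move=> i j /(congr1 val) /= e; apply/val_inj/eqP; rewrite /= -eqz_nat.
  have : (c * (val i)%:Z == c * (val j)%:Z %[mod m%:Z])%Z by rewrite -!redE // e.
  rewrite eqz_mod_dvd -mulrBr Gauss_dvdzr; last by rewrite coprimez_sym.
  by rewrite -eqz_mod_dvd !modz_nat !modn_small ?ltn_ord.
rewrite [RHS](reindex_inj fi); apply: eq_bigr => i _ /=.
by rewrite -hF.
Qed.

Definition twisted_gauss (n : int) : C :=
  \sum_(i < m) conj_char psi (val i)%:Z * ee R m ((val i)%:Z * n).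

Lemma twist_periodic (n z : int) :
  conj_char psi z * ee R m (z * n) = conj_char psi (red m z)%:Z * ee R m ((red m z)%:Z * n).
Proof.
rewrite /conj_char -char_red //; congr (_ * _); apply: ee_eq_mod => //.
by rewrite redE // modzMml.
Qed.

Lemma conj_charM (a b : int) : conj_char psi (a * b) = conj_char psi a * conj_char psi b.
Proof. by case: (psiP) => _ hM _ _; rewrite /conj_char hM rmorphM. Qed.

(** For a unit [n], reindex by [n]. Otherwise reindexing by a witness [c] multiplies the sum by
    [conj_char psi c != 1] without changing it, so both sides vanish. *)
Lemma twisted_gaussE (n : int) : twisted_gauss n = psi n * twisted_gauss 1.
Proof.
have [cn|ncn] := boolP (coprimez n m%:Z).
  rewrite -[X in _ * X](sum_reindex_mul cn (twist_periodic 1)) mulr_sumr.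
  apply: eq_bigr => i _; rewrite conj_charM mulr1 mulrA mulrA.
  by rewrite /conj_char (char_conjM m_gt0 n psiP) cn mul1r [n * _]mulrC.
rewrite (char_eq0 psiP ncn) mul0r.
have [c [cc e c1]] := primitive_witness ncn.
have := sum_reindex_mul cc (twist_periodic n).
rewrite -/(twisted_gauss n).
have -> : \sum_(i < m) conj_char psi (c * (val i)%:Z) * ee R m (c * (val i)%:Z * n)
   = conj_char psi c * twisted_gauss n.
  rewrite mulr_sumr; apply: eq_bigr => i _; rewrite conj_charM -mulrA; congr (_ * (_ * _)).
  apply: ee_eq_mod => //.
  rewrite (_ : c * (val i)%:Z * n = (val i)%:Z * (c * n)); last by ring.
  by rewrite -modzMmr e modzMmr.
move/eqP; rewrite -subr_eq0 -{2}[twisted_gauss n]mul1r -mulrBl mulf_eq0 subr_eq0.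
case/orP => [|/eqP //] /eqP h; case/eqP: c1.
by rewrite -[psi c]conjcK -/(conj_char psi c) h conjc1.
Qed.

(** In the double sum produced by [twisted_gaussE], summing the exponentials over [n] keeps only
    [i = m - 1], the residue of -1, where [psi] is 1. *)
Lemma gauss_norm : even_char psi -> gauss_sum m psi * twisted_gauss 1 = m%:R.
Proof.
move=> ev; rewrite gauss_sumE mulr_suml.
rewrite (eq_bigr (fun n : 'I_m => \sum_(i < m) conj_char psi (val i)%:Z *
   ee R m ((val n)%:Z * ((val i)%:Z + 1)))); last first.
  move=> n _; rewrite mulrAC -twisted_gaussE mulr_suml; apply: eq_bigr => i _.
  by rewrite -mulrA -eeD mulrDr mulr1 [X in X + _]mulrC.
rewrite exchange_big /=.
under eq_bigr do rewrite -mulr_sumr sum_ee //.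
have hm : (m.-1 < m)%N by rewrite prednK.
rewrite (bigD1 (Ordinal hm)) //= big1 ?addr0.
  rewrite -[_ + 1]PoszD addn1 prednK // dvdzz mulr1n.
  suff -> : conj_char psi m.-1%:Z = 1 by rewrite mul1r.
  rewrite /conj_char (@char_eq_mod R m m_gt0 psi _ (-1)) // ?ev ?conjc1 //.
  apply/eqP; rewrite eqz_mod_dvd opprK -[_ + 1]PoszD addn1 prednK //.
move=> i hi; rewrite -[_ + 1]PoszD addn1 dvdzE /=.
case: dvdnP => [[q hq]|]; last by rewrite mulr0n mulr0.
case/eqP: hi; apply: val_inj => /=.
have := ltn_ord i; case: q hq => [|[|q]]; rewrite ?mulSn; lia.
Qed.

Lemma gauss_inversion (n : int) : even_char psi ->
  psi n = gauss_sum m psi / m%:R * twisted_gauss n.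
Proof.
move=> ev; rewrite twisted_gaussE mulrCA mulrAC gauss_norm // mulfV ?mulr1 //.
by rewrite pnatr_eq0 -lt0n.
Qed.

Local Open Scope complex_scope.

(** Averaging over [i] and [- i] turns exponentials into cosines, as [psi] is even. The summand is
    then symmetric under [a -> m - a], and vanishes at 0 and [m / 2], which are not units. *)
Lemma twisted_gauss_cos (n : nat) : (1 < m)%N -> even_char psi ->
  twisted_gauss n%:Z = 2 * \sum_(1 <= a < m | (2 * a < m)%N)
    conj_char psi a%:Z * (cos (2 * pi * (a * n)%:R / m%:R))%:C.
Proof.
move=> m1 ev.
have cN1 : coprimez (-1) m%:Z by rewrite coprimez_sym coprimezN /coprimez gcdz1.
have cNz z : conj_char psi (- z) = conj_char psi z.
  by rewrite -mulN1r conj_charM /conj_char ev conjc1 mul1r.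
have e1 := sum_reindex_mul cN1 (twist_periodic n%:Z).
have two : (2 : C) != 0 by rewrite pnatr_eq0.
pose F a : C := conj_char psi a%:Z * (cos (2 * pi * (a * n)%:R / m%:R))%:C.
have -> : twisted_gauss n%:Z = \sum_(0 <= a < m) F a.
  apply: (mulfI two); rewrite mulr_natl mulr2n -{1}[twisted_gauss _]e1 -big_split /=.
  rewrite big_mkord mulr_sumr; apply: eq_bigr => i _.
  by rewrite !mulN1r cNz -mulrDr mulNr addrC ee_addN mulrCA; congr (_ * (_ * _)).
rewrite big_ltn //.
have -> : F 0%N = 0.
  rewrite /F /conj_char (char_eq0 psiP) ?conjc0 ?mul0r //.
  by rewrite /coprimez gcd0z; apply/eqP => /= -[e]; rewrite e in m1.
rewrite add0r sum_even_nat_fold //.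
- by rewrite mulr_natl.
- move=> a /andP[a0 am].
  have e2 : conj_char psi (m - a)%N%:Z = conj_char psi a%:Z.
    rewrite -[RHS]cNz /conj_char (@char_eq_mod R m m_gt0 psi (m - a)%N%:Z (- a%:Z) psiP) //.
    by rewrite -subzn ?(ltnW am) // addrC modzDr.
  have e3 : 2 * pi * ((m - a) * n)%N%:R / m%:R =
     2 * pi * n%:R - 2 * pi * (a * n)%:R / m%:R :> R.
    by rewrite !natrM natrB ?(ltnW am) //; field; rewrite pnatr_eq0 -lt0n.
  have [c1 s1] := expi_2pi_nat R n.
  by rewrite /F e2 e3 cosB c1 s1 mul1r mul0r addr0.
- move=> a e; rewrite /F /conj_char (char_eq0 psiP) ?conjc0 ?mul0r //.
  have m2 := primitive_gt2 m1.
  rewrite coprimezE /= -e coprimeMr [coprime a a]/coprime gcdnn negb_and.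
  by apply/orP; right; apply/eqP; lia.
Qed.

End Primitive.

Local Open Scope complex_scope.

(** * Expansion in L-values *)

Section Assembly.
Variable R : realType.
Local Notation C := (Cplx R).

Lemma fsbig_dchars d (e : C) (F : (int -> C) -> C) : (0 < d)%N ->
  \sum_(chi \in [set chi | chi \in @dchars R d /\ chi (-1) = e]) F chi =
  \sum_(chi <- dchar_seq R d | chi (-1) == e) F chi.
Proof.
move=> d0.
have fin : finite_set [set chi | chi \in @dchars R d /\ chi (-1) = e].
  by apply: sub_finite_set (finite_dchars R d0) => chi [] /=; rewrite inE.
rewrite fsbig_finite //= -[RHS]big_filter; apply: perm_big; apply: uniq_perm.
- exact: finmap.fset_uniq.
- exact/filter_uniq/dchar_seq_uniq.
move=> chi; rewrite mem_filter in_fset_set //; apply/idP/idP.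
  by rewrite inE /= => -[]; rewrite inE => hc he; rewrite he eqxx; apply/dchar_seqP.
by move=> /andP[/eqP he /(dchar_seqP d0) hc]; rewrite inE /=; split; rewrite ?inE.
Qed.

(** [h d z] stands for ['i * sin(2 pi z / d)] or [cos(2 pi z / d)], and [P] for the matching parity.
    The identity [E] between finite sums is exact: [n = (m / d) k] turns [m^s / n^s] into
    [d^s / k^s]. *)
Lemma Lser_regroup (m s a : nat) (P : pred (int -> C)) (h : nat -> int -> C) (l : C) :
  (0 < m)%N -> (1 < s)%N -> coprime a m ->
  (forall d z, (0 < d)%N -> coprimez z d%:Z ->
    \sum_(chi <- dchar_seq R d | P chi) gauss_sum d (conj_char chi) * chi z =
    (totient d)%:R * h d z) ->
  (forall d k, (d %| m)%N -> h m (a * (m %/ d * k))%N%:Z = h d (a * k)%N%:Z) ->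
  \sum_(1 <= n < N) h m (a * n)%N%:Z / n%:R ^+ s @[N --> \oo] --> l ->
  (m ^ s)%:R * l = \sum_(d <- divisors m) ((d ^ s)%:R / (totient d)%:R *
    \sum_(chi <- dchar_seq R d | P chi)
      (chi a%:Z * gauss_sum d (conj_char chi) * Lser s chi)).
Proof.
move=> m0 s1 am hP hh hl.
pose A d : C := (d ^ s)%:R / (totient d)%:R.
pose B d (chi : int -> C) : C := chi a%:Z * gauss_sum d (conj_char chi).
have E K : (m ^ s)%:R * \sum_(1 <= n < (m * K).+1) h m (a * n)%N%:Z / n%:R ^+ s =
    \sum_(d <- divisors m) (A d * \sum_(chi <- dchar_seq R d | P chi)
      (B d chi * \sum_(1 <= k < (d * K).+1) chi k%:Z / k%:R ^+ s)).
  rewrite (sum_regroup K _ m0) mulr_sumr big_seq [RHS]big_seq; apply: eq_bigr => d.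
  rewrite -dvdn_divisors // => dm.
  have d0 : (0 < d)%N by apply: dvdn_gt0 dm.
  have ad : coprime a d by apply: coprime_dvdr am.
  have t0 : ((totient d)%:R : C) != 0 by rewrite pnatr_eq0 -lt0n totient_gt0.
  under [in RHS]eq_bigr do rewrite mulr_sumr.
  rewrite [in RHS]exchange_big /= [LHS]mulr_sumr [RHS]mulr_sumr [LHS]big_mkcond /=.
  rewrite [LHS]big_nat [RHS]big_nat; apply: eq_bigr => k /andP[k1 _].
  rewrite [RHS](_ : _ = A d * (\sum_(chi <- dchar_seq R d | P chi)
     gauss_sum d (conj_char chi) * chi (a * k)%N%:Z) / k%:R ^+ s); last first.
    rewrite -mulrA mulr_suml; congr (_ * _).
    rewrite big_seq_cond [RHS]big_seq_cond; apply: eq_bigr => chi /andP[/(dchar_seqP d0)[_ hM _ _] _].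
    by rewrite PoszM hM /B; ring.
  case: ifP => ck.
    rewrite hP //; last by rewrite coprimezE /= coprimeMl ad ck.
    rewrite hh // /A !natrX.
    have km : (k%:R : C) != 0 by rewrite pnatr_eq0 -lt0n.
    have dm0 : (d%:R : C) != 0 by rewrite pnatr_eq0 -lt0n.
    have -> : (m%:R : C) = (m %/ d)%:R * d%:R by rewrite -natrM divnK.
    have e0 : ((m %/ d)%:R : C) != 0 by rewrite pnatr_eq0 -lt0n divn_gt0 // dvdn_leq.
    rewrite natrM !exprMn.
    have f1 := expf_neq0 s km; have f2 := expf_neq0 s e0.
    by field; rewrite t0 f1 f2.
  (* The right-hand sum runs over all [k]; the characters themselves vanish at those not prime to
     [d]. *)
  rewrite big_seq_cond big1 ?mulr0 ?mul0r // => chi /andP[/(dchar_seqP d0) hc _].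
  rewrite (char_eq0 hc) ?mulr0 //.
  by rewrite coprimezE /= coprimeMl ad /= ck.
have hf n : (n <= (m * n).+1)%N by rewrite (leq_trans _ (leqnSn _)) // leq_pmull.
have l1 : (m ^ s)%:R * \sum_(1 <= n < (m * K).+1) h m (a * n)%N%:Z / n%:R ^+ s @[K --> \oo]
   --> (m ^ s)%:R * l.
  by apply: cvgMr; exact: (cvg_subseq_nat hf hl).
rewrite (eq_cvg _ _ E) in l1; rewrite -(limC l1).
apply: limC.
have l2 d : d \in divisors m -> xpredT d -> A d * \sum_(chi <- dchar_seq R d | P chi)
      (B d chi * \sum_(1 <= k < (d * K).+1) chi k%:Z / k%:R ^+ s) @[K --> \oo] -->
    A d * \sum_(chi <- dchar_seq R d | P chi) (B d chi * Lser s chi).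
  move=> dd _; have dm : (d %| m)%N by rewrite dvdn_divisors.
  have d0 : (0 < d)%N by apply: dvdn_gt0 dm.
  have l3 chi : chi \in dchar_seq R d -> P chi ->
    B d chi * \sum_(1 <= k < (d * K).+1) chi k%:Z / k%:R ^+ s @[K --> \oo] -->
    B d chi * Lser s chi.
    move=> /(dchar_seqP d0) hc _.
    have hf' n : (n <= (d * n).+1)%N by rewrite (leq_trans _ (leqnSn _)) // leq_pmull.
    apply: cvgC_mull.
    exact: (cvg_subseq_nat hf' (cvg_Lser d0 hc s1)).
  have l4 := @cvgC_sum R _ (dchar_seq R d) P
    (fun chi K => B d chi * \sum_(1 <= k < (d * K).+1) chi k%:Z / k%:R ^+ s)
    (fun chi => B d chi * Lser s chi) l3.
  exact: (@cvgC_mull R (A d) _ _ l4).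
exact: (@cvgC_sum R _ (divisors m) xpredT (fun d K => A d * \sum_(chi <- dchar_seq R d | P chi)
      (B d chi * \sum_(1 <= k < (d * K).+1) chi k%:Z / k%:R ^+ s)) _ l2).
Qed.

End Assembly.

Local Open Scope complex_scope.


(** * Assembly of the formula *)

Section Final.
Variable R : realType.
Local Notation C := (Cplx R).

Lemma angleE (m a n : nat) :
  2 * pi * (a * n)%N%:Z%:~R / m%:R = n.*2%:R * (pi * a%:R / m%:R) :> R.
Proof. by rewrite -pmulrn natrM -muln2 natrM; ring. Qed.

Lemma angle_regroup (m d a k : nat) : (0 < m)%N -> (d %| m)%N ->
  2 * pi * (a * (m %/ d * k))%N%:Z%:~R / m%:R = 2 * pi * (a * k)%N%:Z%:~R / d%:R :> R.
Proof.
move=> m0 dm; have d0 : (0 < d)%N by apply: dvdn_gt0 dm.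
have dn : (d%:R : R) != 0 by rewrite pnatr_eq0 -lt0n.
have en : ((m %/ d)%:R : R) != 0 by rewrite pnatr_eq0 -lt0n divn_gt0 // dvdn_leq.
have -> : (m%:R : R) = (m %/ d)%:R * d%:R by rewrite -natrM divnK.
by rewrite -!pmulrn !natrM; field; rewrite dn en.
Qed.

Lemma sin_sum_C (N k : nat) (x : R) :
  (sin_sum k N x)%:C = \sum_(1 <= n < N) (sin (n.*2%:R * x))%:C / n%:R ^+ k :> C.
Proof.
rewrite /sin_sum rmorph_sum; apply: eq_bigr => n _.
by rewrite rmorphM fmorphV rmorphXn /= rmorph_nat.
Qed.

Lemma cos_sum_C (N k : nat) (x : R) :
  (cos_sum k N x)%:C = \sum_(1 <= n < N) (cos (n.*2%:R * x))%:C / n%:R ^+ k :> C.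
Proof.
rewrite /cos_sum rmorph_sum; apply: eq_bigr => n _.
by rewrite rmorphM fmorphV rmorphXn /= rmorph_nat.
Qed.

Lemma cvg_sin_sum k (x : R) : (1 < k)%N -> cvgn (fun N => sin_sum k N x).
Proof. by move=> k1; apply: (cvg_bounded_dirichlet k1) => n; exact: sin_max. Qed.

Lemma cvg_cos_sum k (x : R) : (1 < k)%N -> cvgn (fun N => cos_sum k N x).
Proof. by move=> k1; apply: (cvg_bounded_dirichlet k1) => n; exact: cos_max. Qed.

Lemma sin_sum_expand (m a k : nat) (l : R) : (0 < m)%N -> (1 < k)%N -> coprime a m ->
  sin_sum k N (pi * a%:R / m%:R) @[N --> \oo] --> l ->
  (m ^ k)%:R * ('i * l%:C) = \sum_(d <- divisors m) ((d ^ k)%:R / (totient d)%:R *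
    \sum_(chi <- dchar_seq R d | chi (-1) == -1)
      (chi a%:Z * gauss_sum d (conj_char chi) * Lser k chi)).
Proof.
move=> m0 k1 am hl.
pose h (d : nat) (z : int) : C := 'i * (sin (2 * pi * z%:~R / d%:R))%:C.
have hP d z : (0 < d)%N -> coprimez z d%:Z ->
    \sum_(chi <- dchar_seq R d | chi (-1) == -1) gauss_sum d (conj_char chi) * chi z =
    (totient d)%:R * h d z.
  by move=> d0; exact: gauss_expand_odd.
have hh d j : (d %| m)%N -> h m (a * (m %/ d * j))%N%:Z = h d (a * j)%N%:Z.
  by move=> dm; rewrite /h angle_regroup.
apply: (Lser_regroup m0 k1 am hP hh).
have E N : \sum_(1 <= n < N) h m (a * n)%N%:Z / n%:R ^+ k =
    'i * (sin_sum k N (pi * a%:R / m%:R))%:C.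
  by rewrite sin_sum_C mulr_sumr; apply: eq_bigr => n _; rewrite /h angleE -[LHS]mulrA.
rewrite (eq_cvg _ _ E).
apply: cvgC_mull; exact: (cvgCr hl).
Qed.

Lemma cos_sum_expand (m a k : nat) (l : R) : (0 < m)%N -> (1 < k)%N -> coprime a m ->
  cos_sum k N (pi * a%:R / m%:R) @[N --> \oo] --> l ->
  (m ^ k)%:R * l%:C = \sum_(d <- divisors m) ((d ^ k)%:R / (totient d)%:R *
    \sum_(chi <- dchar_seq R d | chi (-1) == 1)
      (chi a%:Z * gauss_sum d (conj_char chi) * Lser k chi)) :> C.
Proof.
move=> m0 k1 am hl.
pose h (d : nat) (z : int) : C := (cos (2 * pi * z%:~R / d%:R))%:C.
have hP d z : (0 < d)%N -> coprimez z d%:Z ->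
    \sum_(chi <- dchar_seq R d | chi (-1) == 1) gauss_sum d (conj_char chi) * chi z =
    (totient d)%:R * h d z.
  by move=> d0; exact: gauss_expand_even.
have hh d j : (d %| m)%N -> h m (a * (m %/ d * j))%N%:Z = h d (a * j)%N%:Z.
  by move=> dm; rewrite /h angle_regroup.
apply: (Lser_regroup m0 k1 am hP hh).
have E N : \sum_(1 <= n < N) h m (a * n)%N%:Z / n%:R ^+ k =
    (cos_sum k N (pi * a%:R / m%:R))%:C.
  by rewrite cos_sum_C; apply: eq_bigr => n _; rewrite /h angleE.
rewrite (eq_cvg _ _ E); exact: (cvgCr hl).
Qed.

(** Exchanging the finite sums lets the expansions in [L]-values be applied at each [a]
    separately. *)
Lemma calB_swap (m : nat) (j : int) (psi : int -> C) (A : nat -> C)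
    (P : pred (int -> C)) (B L : nat -> (int -> C) -> C) :
  \sum_(d <- divisors m) (A d * \sum_(chi <- dchar_seq R d | P chi)
     (calB m j (fun a => chi a * conj_char psi a) * B d chi * L d chi)) =
  \sum_(1 <= a < m | (2 * a < m)%N) (conj_char psi a%:Z * (a%:R ^ j *
    \sum_(d <- divisors m) (A d * \sum_(chi <- dchar_seq R d | P chi)
      (chi a%:Z * B d chi * L d chi)))).
Proof.
under [RHS]eq_bigr do rewrite mulrA mulr_sumr.
rewrite [RHS]exchange_big /=; apply: eq_bigr => d _.
under [RHS]eq_bigr do rewrite mulrCA mulr_sumr.
rewrite -[RHS]mulr_sumr; congr (_ * _).
rewrite [RHS]exchange_big /=; apply: eq_bigr => chi _.
rewrite /calB !mulr_suml; apply: eq_bigr => a _.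
ring.
Qed.

Lemma zeta3_cvg : cos_sum 3 M (0 : R) @[M --> \oo] --> zeta R 3.
Proof.
have E M : cos_sum 3 M (0 : R) = \sum_(1 <= n < M) 1 / n%:R ^+ 3.
  by apply: eq_bigr => n _; rewrite mulr0 cos0.
have := @cvg_cos_sum 3 0 isT; rewrite /zeta.
by rewrite (funext E).
Qed.

End Final.

Local Open Scope complex_scope.



(** The contribution of a single [a]: [P], [I], [M], [A] are [pi], ['i], [m], [a]; [cj] is the
    conjugate of [psi a]; [S], [T], [Z], [F] are the limits of [sin_sum 2], [cos_sum 3], [zeta(3)]
    and the binomial series at [x = P A / M]. *)
Lemma term_identity (K : numFieldType) (tau P I M A S T Z F cj : K) :
  P != 0 -> I != 0 -> M != 0 -> A != 0 ->
  tau / M * (2 * (cj * ((4 * (P * A / M) * S + 2 * T - 2 * Z - F) / (4 * (P * A / M) ^+ 2)))) =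
  2 * tau / (P * I * M ^+ 2) * (cj * (A^-1 * (M ^+ 2 * (I * S))))
  + tau / (P ^+ 2 * M ^+ 2) * (cj * ((A ^+ 2)^-1 * (M ^+ 3 * T)))
  - M * tau / P ^+ 2 * ((A ^+ 2)^-1 * cj) * Z
  - M * tau / (2 * P ^+ 2) * (cj * (A ^+ 2)^-1 * F).
Proof. by move=> P0 I0 M0 A0; field; rewrite P0 I0 M0 A0. Qed.

Theorem theorem1 (R : realType) (m : nat) (psi : int -> Cplx R) :
  (1 < m)%N -> primitive_char m psi -> even_char psi ->
  Lser 1 psi =
    2 * gauss_sum m psi / ((pi : R)%:C * 'i * (m ^ 2)%:R) *
      \sum_(d <- divisors m) ((d ^ 2)%:R / (totient d)%:R *
        \sum_(chi \in [set chi | chi \in dchars d /\ odd_char chi])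
          (calB m (-1) (fun a => chi a * conj_char psi a) *
           gauss_sum d (conj_char chi) * Lser 2 chi))
  + gauss_sum m psi / ((pi ^+ 2 : R)%:C * (m ^ 2)%:R) *
      \sum_(d <- divisors m) ((d ^ 3)%:R / (totient d)%:R *
        \sum_(chi \in [set chi | chi \in dchars d /\ even_char chi])
          (calB m (-2) (fun a => chi a * conj_char psi a) *
           gauss_sum d (conj_char chi) * Lser 3 chi))
  - m%:R * gauss_sum m psi / (pi ^+ 2 : R)%:C *
      calB m (-2) (conj_char psi) * (zeta R 3)%:C
  - m%:R * gauss_sum m psi / (2 * (pi ^+ 2 : R)%:C) *
      limn (fun N : nat => \sum_(1 <= n < N)
        (('C(n.*2, n) * n ^ 3)%:R)^-1 *
        \sum_(1 <= a < m | (2 * a < m)%N)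
          (conj_char psi a%:Z * (a%:R : Cplx R) ^ (-2)%Z *
           ((2 * sin (pi * a%:R / m%:R)) ^+ (n.*2) : R)%:C)).
Proof.
move=> m1 hprim ev.
have m0 : (0 < m)%N by apply: ltnW.
have psiP : is_dirichlet_char m psi by case: hprim.
pose x (a : nat) : R := pi * a%:R / m%:R.
have hx a : (1 <= a)%N && (2 * a < m)%N -> 0 < x a < pi / 2.
  move=> /andP[a1 a2].
  have p0 := pi_gt0 R.
  have mp : 0 < m%:R :> R by rewrite ltr0n.
  apply/andP; split; first by rewrite /x divr_gt0 // mulr_gt0 ?ltr0n.
  rewrite /x ltr_pdivrMr // mulrAC ltr_pdivlMr // -mulrA ltr_pM2l //.
  by rewrite -natrM ltr_nat mulnC.
pose S2 a : R := limn (fun N => sin_sum 2 N (x a)).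
pose C3 a : R := limn (fun N => cos_sum 3 N (x a)).
have cS2 a : sin_sum 2 N (x a) @[N --> \oo] --> S2 a by exact: cvg_sin_sum.
have cC3 a : cos_sum 3 N (x a) @[N --> \oo] --> C3 a by exact: cvg_cos_sum.
pose C1 a F : R := (4 * x a * S2 a + 2 * C3 a - 2 * zeta R 3 - F) / (4 * x a ^+ 2).
have [F hF] : exists F : nat -> R, forall a, (1 <= a)%N && (2 * a < m)%N ->
    arc_sum 3 N (x a) @[N --> \oo] --> F a /\
    cos_sum 1 N (x a) @[N --> \oo] --> C1 a (F a).
  have : forall a, exists Fa : R, (1 <= a)%N && (2 * a < m)%N ->
      arc_sum 3 N (x a) @[N --> \oo] --> Fa /\
      cos_sum 1 N (x a) @[N --> \oo] --> C1 a Fa.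
    move=> a; have [ha|_] := boolP ((1 <= a)%N && (2 * a < m)%N); last by exists 0.
    by have [Fa h1 h2] := cvg_cos_sum1 (hx a ha) (cS2 a) (cC3 a) (@zeta3_cvg R); exists Fa.
  by move/choice => [F hF]; exists F.
(* Gauss inversion holds term by term, so the partial sums of [L(1, psi)] are finite combinations of
   [cos_sum 1], whose convergence is known. *)
have H1 : Lser 1 psi = gauss_sum m psi / m%:R *
    (2 * \sum_(1 <= a < m | (2 * a < m)%N) (conj_char psi a%:Z * (C1 a (F a))%:C)).
  apply: limC.
  have E N : \sum_(1 <= n < N) psi n%:Z / n%:R ^+ 1 = gauss_sum m psi / m%:R *
    (2 * \sum_(1 <= a < m | (2 * a < m)%N) (conj_char psi a%:Z * (cos_sum 1 N (x a))%:C)).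
    transitivity (\sum_(1 <= n < N) gauss_sum m psi / m%:R * (2 *
       \sum_(1 <= a < m | (2 * a < m)%N) (conj_char psi a%:Z * ((cos (n.*2%:R * x a))%:C / n%:R ^+ 1)))).
      apply: eq_bigr => n _.
      rewrite (gauss_inversion m0 hprim n%:Z ev) (twisted_gauss_cos m0 hprim n m1 ev).
      rewrite -!mulrA mulr_suml; congr (_ * (_ * (_ * _))).
      apply: eq_bigr => a _; rewrite -mulrA; congr (_ * (_ / _)).
      by have := angleE R m a n; rewrite -pmulrn => ->.
    rewrite -mulr_sumr -mulr_sumr; congr (_ * (_ * _)).
    rewrite exchange_big /=; apply: eq_bigr => a _.
    by rewrite cos_sum_C mulr_sumr.
  rewrite (eq_cvg _ _ E); apply: cvgC_mull; apply: cvgC_mull.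
  have l1 a : a \in index_iota 1 m -> (2 * a < m)%N ->
    conj_char psi a%:Z * (cos_sum 1 N (x a))%:C @[N --> \oo] --> conj_char psi a%:Z * (C1 a (F a))%:C.
    rewrite mem_index_iota => /andP[a1 _] am; apply: cvgC_mull; apply: cvgCr.
    by apply: (hF a _).2; rewrite a1.
  exact: (@cvgC_sum R _ (index_iota 1 m) (fun a => 2 * a < m)%N
    (fun a N => conj_char psi a%:Z * (cos_sum 1 N (x a))%:C) _ l1).
have H2 : limn (fun N : nat => \sum_(1 <= n < N)
        (('C(n.*2, n) * n ^ 3)%:R)^-1 *
        \sum_(1 <= a < m | (2 * a < m)%N)
          (conj_char psi a%:Z * (a%:R : Cplx R) ^ (-2)%Z *
           ((2 * sin (pi * a%:R / m%:R)) ^+ (n.*2) : R)%:C)) =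
  \sum_(1 <= a < m | (2 * a < m)%N)
    (conj_char psi a%:Z * (a%:R : Cplx R) ^ (-2)%Z * (F a)%:C).
  apply: limC.
  have E N : \sum_(1 <= n < N)
        (('C(n.*2, n) * n ^ 3)%:R)^-1 *
        \sum_(1 <= a < m | (2 * a < m)%N)
          (conj_char psi a%:Z * (a%:R : Cplx R) ^ (-2)%Z *
           ((2 * sin (pi * a%:R / m%:R)) ^+ (n.*2) : R)%:C) =
     \sum_(1 <= a < m | (2 * a < m)%N)
       (conj_char psi a%:Z * (a%:R : Cplx R) ^ (-2)%Z * (arc_sum 3 N (x a))%:C).
    under eq_bigr do rewrite mulr_sumr.
    rewrite exchange_big /=; apply: eq_bigr => a _.
    rewrite /arc_sum rmorph_sum mulr_sumr; apply: eq_bigr => n _.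
    rewrite mulrCA; congr (_ * _); rewrite -/(x a).
    rewrite [RHS](fmorph_div (real_complex R)) mulrC; congr (_ / _).
    by rewrite natrM natrX rmorphM rmorphXn /= !rmorph_nat.
  rewrite (eq_cvg _ _ E).
  have l1 a : a \in index_iota 1 m -> (2 * a < m)%N ->
    conj_char psi a%:Z * (a%:R : Cplx R) ^ (-2)%Z * (arc_sum 3 N (x a))%:C @[N --> \oo] -->
    conj_char psi a%:Z * (a%:R : Cplx R) ^ (-2)%Z * (F a)%:C.
    rewrite mem_index_iota => /andP[a1 _] am; apply: cvgC_mull; apply: cvgCr.
    by apply: (hF a _).1; rewrite a1.
  exact: (@cvgC_sum R _ (index_iota 1 m) (fun a => 2 * a < m)%N
    (fun a N => conj_char psi a%:Z * (a%:R : Cplx R) ^ (-2)%Z * (arc_sum 3 N (x a))%:C) _ l1).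
(* Common to both parities, [e] being the sign [chi (-1)]. The expansion of [l a] is assumed for [a]
   prime to [m]; at any other [a] the factor [conj_char psi a] is 0. *)
have T (j : int) (k : nat) (e : Cplx R) (l : nat -> Cplx R) :
   (forall a, coprime a m -> l a = \sum_(d <- divisors m) ((d ^ k)%:R / (totient d)%:R *
      \sum_(chi <- dchar_seq R d | chi (-1) == e)
      (chi a%:Z * gauss_sum d (conj_char chi) * Lser k chi))) ->
   \sum_(d <- divisors m) ((d ^ k)%:R / (totient d)%:R *
        \sum_(chi \in [set chi | chi \in @dchars R d /\ chi (-1) = e])
          (calB m j (fun a => chi a * conj_char psi a) *
           gauss_sum d (conj_char chi) * Lser k chi)) =
   \sum_(1 <= a < m | (2 * a < m)%N) (conj_char psi a%:Z * (a%:R ^ j * l a)).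
  move=> hl.
  transitivity (\sum_(d <- divisors m) ((d ^ k)%:R / (totient d)%:R *
        \sum_(chi <- dchar_seq R d | chi (-1) == e)
          (calB m j (fun a => chi a * conj_char psi a) *
           gauss_sum d (conj_char chi) * Lser k chi))).
    rewrite big_seq [RHS]big_seq; apply: eq_bigr => d; rewrite -dvdn_divisors // => dm.
    by rewrite fsbig_dchars //; apply: dvdn_gt0 dm.
  rewrite (calB_swap m j psi (fun d => (d ^ k)%:R / (totient d)%:R)
    (fun chi => chi (-1) == e) (fun d chi => gauss_sum d (conj_char chi)) (fun d chi => Lser k chi)).
  apply: eq_bigr => a _.
  have [am|nam] := boolP (coprime a m); first by rewrite hl.
  by rewrite /conj_char (char_eq0 psiP) ?conjc0 ?mul0r.
rewrite H1 H2.
rewrite (T (-1) 2%N (-1) (fun a => (m ^ 2)%:R * ('i * (S2 a)%:C))); last first.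
  by move=> a am; exact: (@sin_sum_expand R m a 2 _ m0 isT am (cS2 a)).
rewrite (T (-2) 3%N 1 (fun a => (m ^ 3)%:R * (C3 a)%:C)); last first.
  by move=> a am; exact: (@cos_sum_expand R m a 3 _ m0 isT am (cC3 a)).
move: (gauss_sum m psi) => tau.
(* All parts are now sums over the same [a], and the formula is checked term by term. *)
rewrite /calB !mulr_sumr mulr_suml -big_split /= -!sumrB.
rewrite big_nat_cond [RHS]big_nat_cond; apply: eq_bigr => a /andP[/andP[a1 _] _].
have P0 : ((pi : R)%:C : Cplx R) != 0 by rewrite fmorph_eq0 gt_eqF ?pi_gt0.
have I0 : ('i : Cplx R) != 0 by rewrite eq_complex /= oner_eq0 andbF.
have M0 : (m%:R : Cplx R) != 0 by rewrite pnatr_eq0 -lt0n.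
have A0 : (a%:R : Cplx R) != 0 by rewrite pnatr_eq0 -lt0n.
have := term_identity tau (S2 a)%:C (C3 a)%:C (zeta R 3)%:C (F a)%:C
  (conj_char psi a%:Z) P0 I0 M0 A0.
have -> : (C1 a (F a))%:C = (4 * ((pi : R)%:C * a%:R / m%:R) * (S2 a)%:C + 2 * (C3 a)%:C
   - 2 * (zeta R 3)%:C - (F a)%:C) / (4 * ((pi : R)%:C * a%:R / m%:R) ^+ 2) :> Cplx R.
  rewrite /C1 /x.
  by rewrite !(rmorphM, rmorphB, rmorphD, fmorphV, rmorphXn) /= !rmorph_nat.
by rewrite !natrX rmorphXn.
Qed.
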